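(* Fix $k\in\mathbb N$. For each $j\in\{1,\dots,k\}$, let $(X_j,\rho_j,\mu_j)$ be a space of homogeneous type and let $\{\mathscr D_j^{t_j}:t_j=1,\dots,T_j\}$ be a collection of adjacent systems of dyadic cubes for $X_j$. Then the following hold. (a) A weight $\omega(x_1,\dots,x_k)$ is a product doubling weight if and only if $\omega$ is dyadic doubling with respect to each of the $T_1T_2\cdots T_k$ product dyadic systems $\mathscr D_1^{t_1}\times\cdots\times\mathscr D_k^{t_k}$, where $t_j$ runs over $\{1,\dots,T_j\}$ for each $j\in\{1,\dots,k\}$, with comparable constants. (b) For each $p$ with $1\le p\le\infty$, $$A_p(X_1\times\cdots\times X_k)=\bigcap_{t_1=1}^{T_1}\cdots\bigcap_{t_k=1}^{T_k}A_{p,d}^{t_1,\dots,t_k}(X_1\times\cdots\times X_k),$$ with comparable constants. (c) For each $p$ with $1\le p\le\infty$, $$RH_p(X_1\times\cdots\times X_k)=\bigcap_{t_1=1}^{T_1}\cdots\bigcap_{t_k=1}^{T_k}RH_{p,d}^{t_1,\dots,t_k}(X_1\times\cdots\times X_k),$$ with comparable constants. The constant $A_p(\omega)$ depends only on the constants $A_{p,d}^{t_1,\dots,t_k}(\omega)$ for $1\le t_j\le T_j$, $1\le j\le k$, and vice versa, and similarly for the other classes.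
   Context: **Spaces of homogeneous type.** A quasi-metric on $X$ is a map $\rho:X\times X\to[0,\infty)$ which is symmetric, vanishes exactly on the diagonal, and satisfies $\rho(x,y)\le A_0[\rho(x,z)+\rho(z,y)]$ for a constant $A_0\ge1$. Balls are $B(x,r)=\{y:\rho(x,y)<r\}$. A space of homogeneous type $(X,\rho,\mu)$ is a set with a quasi-metric $\rho$ and a nonzero Borel measure $\mu$ (balls being measurable) such that $\mu(B(x,2r))\le C_\mu\,\mu(B(x,r))<\infty$ for all $x\in X$, $r>0$. Such a space is geometrically doubling: every ball $B(x,r)$ is covered by at most $A_1$ balls of radius $r/2$, for a fixed $A_1\in\mathbb N$. **Dyadic cubes.** A system of dyadic cubes with parameters $\delta\in(0,1)$, $0<c_1\le C_1<\infty$ is a countable family $\mathscr D=\bigcup_{k\in\mathbb Z}\mathscr D_k$, $\mathscr D_k=\{Q^k_\alpha:\alpha\in\mathscr A_k\}$, of Borel sets with: $X=\bigcup_\alpha Q^k_\alpha$ (disjoint union) for each $k$; if $\ell\ge k$ then either $Q^\ell_\beta\subseteq Q^k_\alpha$ or $Q^k_\alpha\cap Q^\ell_\beta=\emptyset$; for each $(k,\alpha)$ and $\ell\le k$ there is a unique $\beta$ with $Q^k_\alpha\subseteq Q^\ell_\beta$; each $Q^k_\alpha$ is the union of the cubes of $\mathscr D_{k+1}$ it contains (its children), whose number is between $1$ and a fixed constant; there are center points $x^k_\alpha\in Q^k_\alpha$ with $B(x^k_\alpha,c_1\delta^k)\subseteq Q^k_\alpha\subseteq B(x^k_\alpha,C_1\delta^k)=:B(Q^k_\alpha)$;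 and if $\ell\ge k$ and $Q^\ell_\beta\subseteq Q^k_\alpha$ then $B(Q^\ell_\beta)\subseteq B(Q^k_\alpha)$. **Adjacent systems.** A collection of adjacent systems is a finite collection $\{\mathscr D^t:t=1,\dots,T\}$ of systems of dyadic cubes with common parameters such that, for some $C\ge1$, for each ball $B(x,r)$ with $\delta^{k+3}<r\le\delta^{k+2}$ there exist $t$ and $Q\in\mathscr D^t$ of generation $k$ with center point ${}^tx^k_\alpha$ satisfying $\rho(x,{}^tx^k_\alpha)<2A_0\delta^k$ and $B(x,r)\subseteq Q\subseteq B(x,Cr)$. The collections used here are those known to exist with parameters $\delta<(96A_0^6)^{-1}$, $c_1=(12A_0^4)^{-1}$, $C_1=4A_0^2$, $C=8A_0^3\delta^{-3}$, and center points with $\rho({}^tx^k_\alpha,{}^tx^k_\beta)\ge(4A_0^2)^{-1}\delta^k$ ($\alpha\ne\beta$) and $\min_\alpha\rho(x,{}^tx^k_\alpha)<2A_0\delta^k$ for all $x$. **One-parameter weight classes on $(X,\rho,\mu)$.** A weight is a nonnegative locally integrable function $\omega:X\to[0,\infty]$; $\omega(E)=\int_E\omega\,d\mu$; $⟨\omega⟩_E=\frac1{\mu(E)}\int_E\omega\,d\mu$. - $\omega$ is *doubling* if there is $C_{\mathrm{dbl}}$ with $0<\omega(B(x,2r))\le C_{\mathrm{dbl}}\,\omega(B(x,r))<\infty$ for all $x\in X$, $r>0$. It is *dyadic doubling* with respect to a system $\mathscr D$ if there is $C_{\mathrm{dydbl}}$ with $0<\omega(Q)\le C_{\mathrm{dydbl}}\,\omega(Q')<\infty$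 for every $Q\in\mathscr D$ and each child $Q'$ of $Q$. - $\omega\in A_p$ if $A_p(\omega)<\infty$, where the suprema are over all balls $B$: $A_p(\omega)=\sup_B⟨\omega⟩_B\,⟨\omega^{-1/(p-1)}⟩_B^{p-1}$ for $1<p<\infty$; $A_1(\omega)=\sup_B⟨\omega⟩_B\,(\operatorname{ess\,inf}_B\omega)^{-1}$; $A_\infty(\omega)=\sup_B⟨\omega⟩_B\exp(⟨\log(1/\omega)⟩_B)$. The dyadic class $A_{p,d}^t$ and constant $A_{p,d}^t(\omega)$ are defined with suprema over cubes $Q\in\mathscr D^t$ instead. - $\omega\in RH_p$ if $RH_p(\omega)<\infty$, where the suprema are over all balls $B$: $RH_p(\omega)=\sup_B⟨\omega^p⟩_B^{1/p}⟨\omega⟩_B^{-1}$ for $1<p<\infty$; $RH_1(\omega)=\sup_B\Big⟨\frac{\omega}{⟨\omega⟩_B}\log\frac{\omega}{⟨\omega⟩_B}\Big⟩_B$; $RH_\infty(\omega)=\sup_B(\operatorname{ess\,sup}_B\omega)⟨\omega⟩_B^{-1}$. For $1\le p\le\infty$, $\omega\in RH_{p,d}^t$ if the analogous condition holds with the supremum over cubes $Q\in\mathscr D^t$ and in addition $\omega$ is dyadic doubling with respect to $\mathscr D^t$; the $RH^t_{p,d}$ constant is the larger of the dyadic supremum and the dyadic doubling constant. **Product classes.** A weight $\omega$ on $X_1\times\cdots\times X_k$ (a nonnegative locally integrable function for the product measure) belongs to the $k$-parameter class (product doubling, $A_p$, $RH_p$, or their dyadic versions with respect to $\mathscr D_1^{t_1}\times\cdots\times\mathscr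 D_k^{t_k}$) if it belongs uniformly to the corresponding one-parameter class in each variable separately: for each $j$ and a.e. choice of the other variables, $x_j\mapsto\omega(x_1,\dots,x_k)$ is in the one-parameter class on $X_j$ (with respect to $\mathscr D_j^{t_j}$ in the dyadic case), with constants bounded uniformly; the constant of $\omega$ is the smallest such uniform bound. ''Comparable constants'' means that each constant on one side of the equivalence is bounded by a quantity depending only on the constants on the other side (and on $p$ and the constants of the underlying spaces and dyadic systems).
   Formalization: In (c), RH_p on the left is replaced by RH_p weights that are also product doubling (constant: the larger of the two), since RH_p on balls does not imply doubling in a general space of homogeneous type, while the dyadic RH classes require dyadic doubling. *)

(* Defs.v *)
From HB Require Import structures.
From mathcomp Require Import all_boot all_order all_algebra.
From mathcomp Require Import all_classical all_reals all_analysis.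
From mathcomp Require Import measurable_realfun.
Set Implicit Arguments.
Unset Strict Implicit.
Unset Printing Implicit Defensive.
Import Order.TTheory GRing.Theory Num.Theory.
Import numFieldNormedType.Exports.
Local Open Scope classical_set_scope.
Local Open Scope ring_scope.

Section insert.
Context (n : nat) (T : 'I_n -> Type) (j : 'I_n).

(* The point of the product whose j-th coordinate is y and whose other
   coordinates, indexed by 'I_n.-1 through [lift j], are given by z. *)
Definition insert (z : forall i : 'I_n.-1, T (lift j i)) (y : T j) :
    forall i, T i :=
  fun i => match unliftP j i with
           | UnliftSome i' e => ecast i (T i) (esym e) (z i')
           | UnliftNone e => ecast i (T i) (esym e) y
           end.

Lemma insert_eq z y : insert z y j = y.
Proof.
rewrite /insert; case: (unliftP j j) => [i e|e].
  by case/eqP: (neq_lift j i).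
by rewrite (_ : esym e = erefl)//; exact: Prop_irrelevance.
Qed.

Lemma insert_lift z y i : insert z y (lift j i) = z i.
Proof.
rewrite /insert; case: (unliftP j (lift j i)) => [i' e|e].
  have ei := lift_inj e; case: _ / ei e => e.
  by rewrite (_ : esym e = erefl)//; exact: Prop_irrelevance.
by case/eqP: (neq_lift j i); exact: esym e.
Qed.

Lemma insertK x : insert (fun i => x (lift j i)) (x j) = x.
Proof.
apply/functional_extensionality_dep => i; rewrite /insert.
by case: (unliftP j i) => [i' e|e]; case: _ / (esym e).
Qed.

End insert.

Section product_space.
Context (n : nat) (d : 'I_n -> measure_display)
  (T : forall i, measurableType (d i)).

Definition rectangles : set (set (forall i, T i)) :=
  [set [set x | forall i, A i (x i)] |
    A in [set A : forall i, set (T i) | forall i, measurable (A i)]].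

Definition product_space := g_sigma_algebraType rectangles.

End product_space.

Arguments rectangles {n d} T _.

Section projections.
Context (n : nat) (d : 'I_n -> measure_display)
  (T : forall i, measurableType (d i)).

Lemma measurable_coord (i : 'I_n) :
  measurable_fun [set: product_space T] (fun x => x i).
Proof.
move=> _ A mA; rewrite setTI; apply: sub_sigma_algebra.
pose B k : set (T k) := dfwith (fun k => [set: T k]) i A k.
exists B.
  move=> k; rewrite /B; case: dfwithP => // l _; exact: measurableT.
apply/seteqP; split=> x /=.
  by move=> /(_ i); rewrite /B dfwithin.
by move=> Axi k; rewrite /B; case: dfwithP.
Qed.

Lemma measurable_fun_product d' (S : measurableType d')
    (f : S -> product_space T) :
  (forall i, measurable_fun [set: S] (fun s => f s i)) ->
  measurable_fun [set: S] f.
Proof.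
move=> mf; apply: (@measurability _ _ S (product_space T) setT f (rectangles T)) => //.
move=> _ [_ [A mA <-] <-]; rewrite setTI.
rewrite (_ : _ @^-1` _ = \bigcap_(i in [set: 'I_n]) ((fun s => f s i) @^-1` A i)).
  apply: fin_bigcap_measurable => // i _.
  by rewrite -[X in measurable X]setTI; exact: mf.
by apply/seteqP; split=> s /= h i; [move=> _|]; exact: h.
Qed.

End projections.

Section measurable_insert.
Context (n : nat) (d : 'I_n -> measure_display)
  (T : forall i, measurableType (d i)).

Lemma measurable_insert (j : 'I_n) :
  measurable_fun [set: T j * product_space (fun i : 'I_n.-1 => T (lift j i))]
    (fun p => insert p.2 p.1 : product_space T).
Proof.
apply: measurable_fun_product => i; rewrite /insert.
case: (unliftP j i) => [i' e|e].
  case: _ / (esym e) => /=.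
  pose T' (l : 'I_n.-1) := T (lift j l).
  exact: (@measurableT_comp _ _ _ _ _ _ (fun z : product_space T' => z i')
    setT snd (@measurable_coord _ _ T' i') measurable_snd).
by case: _ / (esym e) => /=; exact: measurable_fst.
Qed.

End measurable_insert.

Section product_cons.
Local Open Scope ereal_scope.
Context (R : realType) (n : nat) (d : 'I_n.+1 -> measure_display)
  (T : forall i, measurableType (d i)).
Let T' (i : 'I_n) := T (lift ord0 i).
Context (m : {sigma_finite_measure set (T ord0) -> \bar R})
  (m' : {sigma_finite_measure set (product_space T') -> \bar R}).
Let cons (p : T ord0 * product_space T') : product_space T :=
  @insert _ T ord0 p.2 p.1.

Definition product_cons : set (product_space T) -> \bar R :=
  pushforward (m \x m') cons.

Let mcons (A : set (product_space T)) : measurable A ->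
  measurable (cons @^-1` A).
Proof.
move=> mA; have := @measurable_insert _ _ T ord0 measurableT A mA.
by rewrite setTI.
Qed.

Let product_cons0 : product_cons set0 = 0.
Proof. by rewrite /product_cons /pushforward preimage_set0 measure0. Qed.

Let product_cons_ge0 A : 0 <= product_cons A.
Proof. by rewrite /product_cons /pushforward measure_ge0. Qed.

Let product_cons_sigma_additive : semi_sigma_additive product_cons.
Proof.
move=> F mF tF mUF; rewrite /product_cons /pushforward preimage_bigcup.
apply: measure_semi_sigma_additive.
- by move=> i; exact: mcons.
- apply/trivIsetP => /= i j _ _ ij; rewrite -preimage_setI.
  by move/trivIsetP : tF => /(_ _ _ _ _ ij) ->//; rewrite preimage_set0.
- by rewrite -preimage_bigcup; exact: mcons.
Qed.

HB.instance Definition _ := isMeasure.Build _ _ _ product_cons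
  product_cons0 product_cons_ge0 product_cons_sigma_additive.

Lemma product_cons_rectangle (A : forall i, set (T i)) :
  (forall i, measurable (A i)) ->
  product_cons [set x | forall i, A i (x i)] =
  m (A ord0) * m' [set z | forall i, A (lift ord0 i) (z i)].
Proof.
move=> mA; rewrite /product_cons /pushforward.
set A' := [set z : product_space T' | forall i, A (lift ord0 i) (z i)].
have mA' : measurable A'.
  by apply: sub_sigma_algebra; exists (fun i => A (lift ord0 i)).
rewrite (_ : _ @^-1` _ = A ord0 `*` A') ?product_measure1E//.
apply/seteqP; split=> -[y z] /=; rewrite /cons /=.
  move=> h; split; first by have := h ord0; rewrite insert_eq.
  by move=> i; have := h (lift ord0 i); rewrite insert_lift.
move=> [hy hz] i; have [i' ->|->] := unliftP ord0 i.
  by rewrite insert_lift; exact: hz.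
by rewrite insert_eq.
Qed.

Let product_cons_sigma_finite : sigma_finite setT product_cons.
Proof.
have /sigma_finiteP[F [FT ndF Foo]] := sigma_finiteT m.
have /sigma_finiteP[G [GT ndG Goo]] := sigma_finiteT m'.
pose uncons (x : product_space T) : T ord0 * product_space T' :=
  (x ord0, fun i => x (lift ord0 i)).
have muncons : measurable_fun [set: product_space T] uncons.
  apply/measurable_fun_pairP; split; first exact: measurable_coord.
  apply: measurable_fun_product => i; exact: measurable_coord.
have consK : cancel cons uncons.
  move=> [y z]; rewrite /uncons /cons insert_eq /=; congr pair.
  by apply/functional_extensionality_dep => i; rewrite insert_lift.
exists (fun k => uncons @^-1` (F k `*` G k)).
  apply/esym/seteqP; split=> // x _.
  have [i _ Fi] : (\bigcup_i F i) (uncons x).1 by rewrite -FT.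
  have [j _ Gj] : (\bigcup_i G i) (uncons x).2 by rewrite -GT.
  exists (maxn i j) => //; split.
    by move: Fi; exact/subsetPset/ndF/leq_maxl.
  by move: Gj; exact/subsetPset/ndG/leq_maxr.
move=> k; have [mF Fk] := Foo k; have [mG Gk] := Goo k; split.
  rewrite -[X in measurable X]setTI; apply: muncons => //.
  exact: measurableX.
rewrite /product_cons /pushforward -comp_preimage.
rewrite (_ : uncons \o cons = id); last exact/funext/consK.
by rewrite preimage_id product_measure1E// lte_mul_pinfty// ge0_fin_numE.
Qed.

HB.instance Definition _ := Measure_isSigmaFinite.Build _ _ _ product_cons
  product_cons_sigma_finite.

End product_cons.

Section product_measure.
Context (R : realType).

Fixpoint product_measure (n : nat) :
    forall (d : 'I_n -> measure_display) (T : forall i, measurableType (d i)),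
    (forall i, {sigma_finite_measure set (T i) -> \bar R}) ->
    {sigma_finite_measure set (product_space T) -> \bar R} :=
  match n with
  | 0 => fun d T m => \d_(point : product_space T)
  | n'.+1 => fun d T m =>
      product_cons (m ord0) (product_measure (fun i => m (lift ord0 i)))
  end.

Lemma product_measure_rectangle (n : nat) (d : 'I_n -> measure_display)
    (T : forall i, measurableType (d i))
    (m : forall i, {sigma_finite_measure set (T i) -> \bar R})
    (A : forall i, set (T i)) :
  (forall i, measurable (A i)) ->
  product_measure m [set x | forall i, A i (x i)] = (\prod_i m i (A i))%E.
Proof.
elim: n d T m A => [|n IH] d T m A mA /=.
  by rewrite big_ord0 diracE mem_set//= => -[].
rewrite product_cons_rectangle// big_ord_recl; congr (_ * _)%E.
exact: (IH _ _ _ (fun i => A (lift ord0 i))).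
Qed.

End product_measure.

Section quasi_metric.
Context (R : realType) (X : Type) (rho : X -> X -> R).

Record is_quasi_metric (A0 : R) : Prop := IsQuasiMetric {
  qm_constant_ge1 : 1 <= A0;
  qm_ge0 : forall x y, 0 <= rho x y;
  qm_sym : forall x y, rho x y = rho y x;
  qm_eq0 : forall x y, rho x y = 0 <-> x = y;
  qm_triangle : forall x y z, rho x y <= A0 * (rho x z + rho z y) }.

Definition qball (x : X) (r : R) : set X := [set y | rho x y < r].

Definition qopen (U : set X) : Prop :=
  forall x, U x -> exists2 r, 0 < r & qball x r `<=` U.

End quasi_metric.

(* Balls need not be open for the topology induced by a quasi-metric, which is
   why their measurability is a separate requirement. *)
Record homogeneous_space (R : realType) (A0 Cmu : R) := HomogeneousSpace {
  disp : measure_display;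
  carrier :> measurableType disp;
  rho : carrier -> carrier -> R;
  measure_of : {measure set carrier -> \bar R};
  rho_quasi_metric : is_quasi_metric rho A0;
  measurable_qopen : forall U, qopen rho U -> measurable U;
  measurable_qball : forall x r, measurable (qball rho x r);
  vol_neq0 : measure_of setT != 0%E;
  vol_doubling : forall x r, 0 < r ->
    (measure_of (qball rho x (2 * r)) <= Cmu%:E * measure_of (qball rho x r))%E;
  vol_qball_lty : forall x r, 0 < r -> (measure_of (qball rho x r) < +oo)%E }.

Arguments rho {R A0 Cmu h}.
Arguments measure_of {R A0 Cmu} h.

Local Notation B x r := (qball rho x r).

Section vol.
Context (R : realType) (A0 Cmu : R) (X : homogeneous_space A0 Cmu).

Definition vol : set X -> \bar R := measure_of X.

HB.instance Definition _ := Measure.on vol.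

Let sigma_finite_vol : sigma_finite [set: X] vol.
Proof.
exists (fun n => B (point : X) n.+1%:R).
  apply/esym/seteqP; split=> // x _; exists (Num.truncn (rho (point : X) x)) => //.
  by rewrite /qball /= truncnS_gt.
by move=> n; split; [exact: measurable_qball | exact: vol_qball_lty].
Qed.

HB.instance Definition _ := Measure_isSigmaFinite.Build _ _ _ vol
  sigma_finite_vol.

End vol.

Arguments vol {R A0 Cmu} X.

Section dyadic.
Context (R : realType) (A0 Cmu : R) (X : homogeneous_space A0 Cmu).

(* The k-th generation is indexed by [idx k]; a set may be a cube of several
   generations, so that cubes are handled through their indices. *)
Record dyadic_system (delta c1 C1 : R) (N : nat) := DyadicSystem {
  idx : int -> Type;
  cube : forall k, idx k -> set X;
  center : forall k, idx k -> X;
  outer_ball k (a : idx k) := B (center a) (C1 * delta ^ k);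
  children k (a : idx k) := [set b : idx (k + 1) | cube b `<=` cube a];
  delta_gt0 : 0 < delta;
  delta_lt1 : delta < 1;
  c1_gt0 : 0 < c1;
  c1_leC1 : c1 <= C1;
  countable_idx : forall k, countable [set: idx k];
  measurable_cube : forall k (a : idx k), measurable (cube a);
  cube_cover : forall k, \bigcup_(a in [set: idx k]) cube a = setT;
  cube_disjoint : forall k (a b : idx k), a <> b -> cube a `&` cube b = set0;
  cube_nested : forall k l (a : idx k) (b : idx l), k <= l ->
    cube b `<=` cube a \/ cube a `&` cube b = set0;
  cube_ancestor : forall k l (a : idx k), l <= k ->
    exists! b : idx l, cube a `<=` cube b;
  cube_children : forall k (a : idx k),
    cube a = \bigcup_(b in children a) cube b;
  children_neq0 : forall k (a : idx k), children a !=set0;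
  children_le : forall k (a : idx k), (children a #<= `I_N)%card;
  cube_center : forall k (a : idx k), cube a (center a);
  ball_sub_cube : forall k (a : idx k), B (center a) (c1 * delta ^ k) `<=` cube a;
  cube_sub_ball : forall k (a : idx k), cube a `<=` outer_ball a;
  outer_ball_nested : forall k l (a : idx k) (b : idx l), k <= l ->
    cube b `<=` cube a -> outer_ball b `<=` outer_ball a }.

Record adjacent_systems (delta : R) (T N : nat)
    (c1 := (12 * A0 ^+ 4)^-1) (C1 := 4 * A0 ^+ 2)
    (C := 8 * A0 ^+ 3 * delta ^- 3) := AdjacentSystems {
  system :> 'I_T -> dyadic_system delta c1 C1 N;
  delta_lt : delta < (96 * A0 ^+ 6)^-1;
  adjacent_cover : forall (k : int) (x : X) (r : R),
    delta ^ (k + 3) < r <= delta ^ (k + 2) ->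
    exists t (a : idx (system t) k),
      [/\ rho x (center a) < 2 * A0 * delta ^ k,
          B x r `<=` cube a & cube a `<=` B x (C * r)];
  center_separated : forall t k (a b : idx (system t) k), a <> b ->
    (4 * A0 ^+ 2)^-1 * delta ^ k <= rho (center a) (center b);
  center_dense : forall t k (x : X),
    exists a : idx (system t) k, rho x (center a) < 2 * A0 * delta ^ k }.

End dyadic.

Section one_parameter.
Local Open Scope ereal_scope.
Context (R : realType) (A0 Cmu : R) (X : homogeneous_space A0 Cmu).
Implicit Types (w : X -> \bar R) (E : set X) (F : set (set X)) (p : \bar R).

Definition is_weight w :=
  [/\ measurable_fun [set: X] w, forall x, 0 <= w x &
      forall x r, \int[vol X]_(y in B x r) w y < +oo].

Definition mass w E := \int[vol X]_(y in E) w y.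

Definition avg w E := (vol X E)^-1 * mass w E.

Definition ess_inf_on w E :=
  ereal_sup [set y | {ae vol X, forall x, E x -> y <= w x}].

Definition ess_sup_on w E :=
  ereal_inf [set y | {ae vol X, forall x, E x -> w x <= y}].

(* w^(-1/(q-1)) is written as (1/w)^(1/(q-1)): [inve] sends 0 to +oo, whereas
   [poweR] sends 0 to 0 for every nonzero exponent. The value at p = -oo is
   irrelevant, p being at least 1 throughout. *)
Definition muckenhoupt_on p w E :=
  match p with
  | q%:E => if q == 1%R then avg w E * (ess_inf_on w E)^-1
            else avg w E *
              (avg (fun x => ((w x)^-1) `^ ((q - 1)^-1)%R) E) `^ (q - 1)%R
  | +oo => avg w E * expeR (avg (fun x => lne ((w x)^-1)) E)
  | -oo => 0
  end.

Definition reverse_hoelder_on p w E :=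
  match p with
  | q%:E => if q == 1%R then avg (fun x => (w x / avg w E) * lne (w x / avg w E)) E
            else (avg (fun x => (w x) `^ q) E) `^ (q^-1)%R * (avg w E)^-1
  | +oo => ess_sup_on w E * (avg w E)^-1
  | -oo => 0
  end.

Definition balls : set (set X) := [set E | exists x r, (0 < r)%R /\ E = B x r].

(* A one-parameter class is the relation "w satisfies the defining condition
   of the class with constant at most C". *)
Definition weight_class := (X -> \bar R) -> R -> Prop.

Definition muckenhoupt F p : weight_class := fun w C =>
  ereal_sup [set muckenhoupt_on p w E | E in F] <= C%:E.

Definition reverse_hoelder F p : weight_class := fun w C =>
  ereal_sup [set reverse_hoelder_on p w E | E in F] <= C%:E.

Definition doubling : weight_class := fun w C =>
  forall x r, (0 < r)%R ->
    [/\ 0 < mass w (B x (2 * r)),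
        mass w (B x (2 * r)) <= C%:E * mass w (B x r) &
        C%:E * mass w (B x r) < +oo].

Section dyadic_classes.
Context (delta c1 C1 : R) (N : nat) (D : dyadic_system X delta c1 C1 N).

Definition cubes : set (set X) := [set E | exists k (a : idx D k), E = cube a].

Definition dyadic_doubling : weight_class := fun w C =>
  forall k (a : idx D k) (b : idx D (k + 1)), children a b ->
    [/\ 0 < mass w (cube a), mass w (cube a) <= C%:E * mass w (cube b) &
        C%:E * mass w (cube b) < +oo].

(* The conjunction makes the least admissible C the larger of the supremum over
   cubes and the dyadic doubling constant. *)
Definition dyadic_reverse_hoelder p : weight_class := fun w C =>
  reverse_hoelder cubes p w C /\ dyadic_doubling w C.

End dyadic_classes.
End one_parameter.

Arguments balls {R A0 Cmu X}.
Arguments doubling {R A0 Cmu X}.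

(* The constants of a factor and of its adjacent dyadic systems; the remaining
   parameters c_1, C_1 and C of the systems are functions of these. *)
Record geometry (R : realType) := Geometry {
  geo_A0 : R; geo_Cmu : R; geo_delta : R; geo_T : nat; geo_N : nat }.

Section product_classes.
Local Open Scope ereal_scope.
Context (R : realType) (k : nat) (g : 'I_k -> geometry R)
  (X : forall j, homogeneous_space (geo_A0 (g j)) (geo_Cmu (g j))).

Definition product_carrier := product_space (fun j => X j : measurableType _).

Definition product_vol : {sigma_finite_measure set product_carrier -> \bar R} :=
  product_measure (fun j => vol (X j)).

(* The product measure in the variables other than the j-th. *)
Definition other_vol (j : 'I_k) :=
  product_measure (fun i : 'I_k.-1 => vol (X (lift j i))).

Implicit Types w : product_carrier -> \bar R.

(* Local integrability is integrability on bounded sets, i.e. on products of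
   balls; likewise in [is_weight]. *)
Definition is_product_weight w :=
  [/\ measurable_fun [set: product_carrier] w, forall x, 0 <= w x &
      forall (x : product_carrier) (r : 'I_k -> R),
        \int[product_vol]_(y in [set y | forall j, B (x j) (r j) (y j)]) w y
          < +oo].

Section class.
Variable cls : forall j, weight_class (X j).

Definition uniformly_in w (C : R) :=
  forall j, {ae other_vol j, forall z,
    let w_j (y : X j) := w (insert z y) in is_weight w_j /\ cls w_j C}.

Definition product_class : set (product_carrier -> \bar R) :=
  [set w | is_product_weight w /\ exists C, uniformly_in w C].

Definition product_constant w : \bar R :=
  ereal_inf [set C%:E | C in [set C | uniformly_in w C]].

End class.

End product_classes.

Arguments is_product_weight {R k g} X w.
Arguments product_class {R k g X} cls w.
Arguments product_constant {R k g X} cls w.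

Section product_weights.
Context (R : realType) (k : nat) (g : 'I_k -> geometry R).
Variable X : forall j, homogeneous_space (geo_A0 (g j)) (geo_Cmu (g j)).
Implicit Types (j : 'I_k) (p : \bar R).

Definition Dbl j : weight_class (X j) := doubling.
Definition Ap p j : weight_class (X j) := muckenhoupt balls p.
Definition RH p j : weight_class (X j) := reverse_hoelder balls p.

Variable D : forall j,
  adjacent_systems (X j) (geo_delta (g j)) (geo_T (g j)) (geo_N (g j)).
Variable t : forall j, 'I_(geo_T (g j)).

Definition Dbl_d j : weight_class (X j) := dyadic_doubling (D j (t j)).
Definition Ap_d p j : weight_class (X j) := muckenhoupt (cubes (D j (t j))) p.
Definition RH_d p j : weight_class (X j) := dyadic_reverse_hoelder (D j (t j)) p.

End product_weights.

Arguments Dbl {R k g} X j w C.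
Arguments Ap {R k g} X p j w C.
Arguments RH {R k g} X p j w C.
Arguments Dbl_d {R k g X} D t j w C.
Arguments Ap_d {R k g X} D t p j w C.
Arguments RH_d {R k g X} D t p j w C.

(* The constant c and the family of constants cd are each bounded by a
   function of the other. *)
Definition comparable_constants (R : realType) (I : Type) (Phi Psi : R -> R)
    (c : \bar R) (cd : I -> \bar R) :=
  (forall M : R, (c <= M%:E)%E -> forall t, (cd t <= (Phi M)%:E)%E) /\
  (forall M : R, (forall t, (cd t <= M%:E)%E) -> (c <= (Psi M)%:E)%E).

(* Main.v *)
(** Every cube Q lies in its outer ball, of measure at most a multiple of that
of Q, and every ball B lies in a cube of one of the adjacent systems, which in
turn lies in a fixed dilate of B. If E is contained in F and
mu(F) <= K mu(E), the A_p quantity of w on E is at most a function of the one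
on F; so is the RH_p quantity if moreover w(F) <= L w(E), which doubling
provides. For finite exponents other than RH_1 this is monotonicity of the
integral of a nonnegative function. The logarithms in A_oo and RH_1 change
sign, but log u <= u and u log u >= -1 bound the integral over F of their
negative part, so the integral of the positive part, which is monotone in the
set, is controlled as well. Dyadic doubling in all systems gives doubling: cover
B(x, 2r) by a cube Q of comparable size, and descend a fixed number of
generations from Q, along the cubes containing x, to reach one inside B(x, r).
The product statement follows coordinate by coordinate. *)
Require Import Defs.
From mathcomp Require Import all_boot all_order all_algebra.
From mathcomp Require Import all_classical all_reals all_analysis.
From mathcomp Require Import measurable_realfun ring lra.
Set Implicit Arguments.
Unset Strict Implicit.
Unset Printing Implicit Defensive.
Import Order.TTheory GRing.Theory Num.Theory.
Import numFieldNormedType.Exports.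
Import Defs.
Local Open Scope classical_set_scope.
Local Open Scope ring_scope.

Local Notation B x r := (qball rho x r).

(** * Powers of two and geometric scales *)

Lemma exp2_dominates (R : realType) (x : R) : exists n, x <= 2 ^+ n.
Proof.
exists (Num.truncn x).+1; apply: le_trans (ltW (truncnS_gt x)) _.
by rewrite -natrX ler_nat ltnW// ltn_expl.
Qed.

Lemma expr_below (R : realType) (q e : R) : 0 < q < 1 -> 0 < e ->
  exists n, q ^+ n < e.
Proof.
move=> /andP[q0 q1] e0.
have : (fun n => q ^+ n) @ \oo --> 0 by apply: cvg_expr; rewrite gtr0_norm.
move/cvgrPdist_lt => /(_ _ e0)[n _ /(_ n (leqnn n))].
by rewrite sub0r normrN gtr0_norm ?exprn_gt0//; exists n.
Qed.

(** Multiplying by a power [q ^+ m] that brings [r] below 1 leaves only natural exponents to search: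
    [k + m + 1] is the least [n] with [q ^+ n < r * q ^+ m]. *)
Lemma geometric_scale (R : realType) (q r : R) : 0 < q < 1 -> 0 < r ->
  exists k : int, q ^ (k + 1) < r <= q ^ k.
Proof.
move=> q01 r0; have [q0 q1] := andP q01.
have [m hm] := expr_below q01 (divr_gt0 ltr01 r0).
have hex : exists n, q ^+ n < r * q ^+ m.
  by apply: expr_below => //; rewrite mulr_gt0// exprn_gt0.
case: (ex_minnP hex) => -[|n] hn hmin.
  move: hn; rewrite expr0 ltNge; case/negP.
  by rewrite mulrC -ler_pdivlMr// ltW.
exists (n%:Z - m%:Z).
have qm : 0 < q ^+ m by rewrite exprn_gt0.
have -> : (n%:Z - m%:Z + 1 = n.+1%:Z - m%:Z) by rewrite intS; ring.
rewrite !expfzDr ?gt_eqF// -!invr_expz.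
rewrite -!exprnP ltr_pdivrMr// hn ler_pdivlMr//=.
by rewrite leNgt; apply/negP => /hmin; rewrite ltnn.
Qed.

(** * Balls and cubes *)

Section space.
Context (R : realType) (A0 Cmu : R) (X : homogeneous_space A0 Cmu).
Implicit Types (x y : X) (r s : R) (w : X -> \bar R) (E F : set X).

Local Notation qm := (rho_quasi_metric X).

Lemma A0_ge1 : 1 <= A0. Proof. exact: qm_constant_ge1 qm. Qed.

Lemma qball_center x r : 0 < r -> B x r x.
Proof. by rewrite /qball /= => r0; rewrite (qm_eq0 qm x x).2. Qed.

Lemma sub_qball x r s : r <= s -> B x r `<=` B x s.
Proof. by move=> rs y; rewrite /qball /= => /lt_le_trans; apply. Qed.

Lemma qball_recenter x y r s : B x r y -> 2 * A0 * r <= s ->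
  B x r `<=` B y s.
Proof.
rewrite /qball /= => xy rs z /= xz; apply: lt_le_trans rs.
apply: le_lt_trans (qm_triangle qm y z x) _.
rewrite [2 * A0]mulrC -mulrA mulrDl !mul1r ltr_pM2l.
  by rewrite ltrD// (qm_sym qm).
by rewrite (lt_le_trans _ A0_ge1).
Qed.

(** If one ball were null, doubling would make all its dilates null, and these exhaust the space,
    whose measure is not zero. *)
Lemma vol_qball_gt0 x r : 0 < r -> (0 < vol X (B x r))%E.
Proof.
move=> r0; rewrite lt0e measure_ge0 andbT; apply/eqP => v0.
have vn n : vol X (B x (2 ^+ n * r)) = 0%E.
  elim: n => [|n IH]; first by rewrite expr0 mul1r.
  apply/eqP; rewrite eq_le measure_ge0 andbT exprS -mulrA.
  apply: le_trans (vol_doubling x _) _; first by rewrite mulr_gt0// exprn_gt0.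
  by rewrite [measure_of X _]IH mule0.
have /negP := vol_neq0 X; apply.
have -> : [set: X] = \bigcup_n B x (2 ^+ n * r).
  apply/esym/seteqP; split=> // y _.
  have [n hn] := exp2_dominates ((rho x y + 1) / r).
  exists n => //; rewrite /qball /= -ltr_pdivrMr//; apply: lt_le_trans hn.
  by rewrite ltr_pM2r ?invr_gt0// ltrDl.
rewrite -[measure_of X _]/(vol X _) -measure_le0.
pose F n := B x (2 ^+ n * r).
have mF n : measurable (F n) by exact: measurable_qball.
have mUF : measurable (\bigcup_n F n) by exact: bigcup_measurable.
apply: le_trans (measure_sigma_subadditive (vol X) mF mUF (@subset_refl _ _)) _.
by rewrite eseries0// => n _ _; exact: vn.
Qed.

Lemma Cmu_ge0 : 0 <= Cmu.
Proof.
have v0 := vol_qball_gt0 point ltr01.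
have := le_trans (measure_ge0 (vol X) _) (vol_doubling (point : X) ltr01).
by rewrite [measure_of X _]/(vol X _) pmule_lge0 ?lee_fin.
Qed.

(** [f] is left arbitrary because the iteration serves both the volume and the mass of a weight, as
    functions of the radius. *)
Lemma iter_doubling (f : R -> \bar R) (C : R) (n : nat) r : 0 <= C -> 0 < r ->
  (forall s, 0 < s -> (f (2 * s)%R <= C%:E * f s)%E) ->
  (f (2 ^+ n * r)%R <= (C ^+ n)%:E * f r)%E.
Proof.
move=> C0 r0 fC; elim: n => [|n IH]; first by rewrite !expr0 mul1r mul1e.
rewrite exprS -mulrA (le_trans (fC _ _)) ?mulr_gt0 ?exprn_gt0//.
by rewrite exprS EFinM -muleA lee_wpmul2l ?lee_fin.
Qed.

Lemma vol_qball_scale n x r : 0 < r ->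
  (vol X (B x (2 ^+ n * r)%R) <= (Cmu ^+ n)%:E * vol X (B x r))%E.
Proof.
move=> r0; apply: (iter_doubling (f := fun r => vol X (B x r))) => //.
  exact: Cmu_ge0.
by move=> s; exact: vol_doubling.
Qed.

(** Common form of a cube in its outer ball and a ball in its adjacent cube. The ball inside [E]
    makes volumes positive; the ball around [F] makes volumes and masses finite. *)
Record comparable_sets (K : R) (E F : set X) : Prop := Comparable {
  comparable_measl : measurable E;
  comparable_measr : measurable F;
  comparable_sub : E `<=` F;
  comparable_fat : exists x r, 0 < r /\ B x r `<=` E;
  comparable_bounded : exists x r, 0 < r /\ F `<=` B x r;
  comparable_vol : (vol X F <= K%:E * vol X E)%E }.

Lemma comparable_vol_gt0 K E F : comparable_sets K E F -> (0 < vol X E)%E.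
Proof.
move=> [mE _ _ [x [r [r0 xE]]] _ _]; apply: lt_le_trans (vol_qball_gt0 x r0) _.
by apply: le_measure => //; rewrite inE//; exact: measurable_qball.
Qed.

Lemma comparable_vol_lty K E F : comparable_sets K E F -> (vol X F < +oo)%E.
Proof.
move=> [_ mF _ _ [x [r [r0 Fx]]] _]; apply: le_lt_trans (vol_qball_lty x r0).
by apply: le_measure => //; rewrite inE//; exact: measurable_qball.
Qed.

(** * Mass of a weight and the doubling condition *)

Section weight.
Variable w : X -> \bar R.
Hypothesis w_weight : is_weight w.

Let mw : measurable_fun setT w. Proof. by case: w_weight. Qed.
Let w_ge0 x : (0 <= w x)%E. Proof. by case: w_weight. Qed.

Lemma mass_ge0 E : (0 <= mass w E)%E.
Proof. by apply: integral_ge0. Qed.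

Lemma le_mass E F : measurable E -> measurable F -> E `<=` F ->
  (mass w E <= mass w F)%E.
Proof.
move=> mE mF EF; apply: ge0_subset_integral => //.
exact: measurable_funTS.
Qed.

Lemma mass_lty E : measurable E -> (exists x r, 0 < r /\ E `<=` B x r) ->
  (mass w E < +oo)%E.
Proof.
move=> mE [x [r [_ Ex]]]; case: w_weight => _ _ /(_ x r); apply: le_lt_trans.
by apply: le_mass => //; exact: measurable_qball.
Qed.

Lemma doubling_gt0 C : doubling w C -> 0 < C.
Proof.
move=> /(_ point 1 ltr01)[h1 h2 _].
have := lt_le_trans h1 h2; rewrite ltNge => /negP h; rewrite ltNge.
by apply/negP => C0; apply: h; rewrite mule_le0_ge0 ?lee_fin// mass_ge0.
Qed.

Lemma doubling_scale C n x r : doubling w C -> 0 < r ->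
  (mass w (B x (2 ^+ n * r)%R) <= (C ^+ n)%:E * mass w (B x r))%E.
Proof.
move=> wC r0; apply: (iter_doubling (f := fun r => mass w (B x r))) => //.
  exact/ltW/(doubling_gt0 wC).
by move=> s s0; case: (wC x s s0).
Qed.

Lemma doubling_qball_gt0 C x r : doubling w C -> 0 < r -> (0 < mass w (B x r))%E.
Proof.
move=> wC r0; have r20 : 0 < r / 2 by rewrite divr_gt0.
by have [+ _ _] := wC x _ r20; rewrite mulrCA mulfV// mulr1.
Qed.

Lemma doubling_le C C' : C <= C' -> doubling w C -> doubling w C'.
Proof.
move=> CC' wC x r r0; have [h1 h2 h3] := wC x r r0; split => //.
  by apply: le_trans h2 _; rewrite lee_wpmul2r ?lee_fin// mass_ge0.
rewrite lte_mul_pinfty ?lee_fin//.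
  exact: le_trans (ltW (doubling_gt0 wC)) CC'.
rewrite mass_lty//; first exact: measurable_qball.
by exists x, r; split.
Qed.

End weight.

(** * Dyadic cubes and dyadic doubling *)

Section dyadic.
Context (delta c1 C1 : R) (N : nat) (D : dyadic_system X delta c1 C1 N).
Variable w : X -> \bar R.
Hypothesis w_weight : is_weight w.

Let scale_gt0 k : 0 < delta ^ k. Proof. by rewrite exprz_gt0// (delta_gt0 D). Qed.
Let c1_gt0 := c1_gt0 D.
Let C1_gt0 : 0 < C1. Proof. exact: lt_le_trans c1_gt0 (c1_leC1 D). Qed.

Lemma cube_fat k (a : idx D k) : exists x r, 0 < r /\ B x r `<=` cube a.
Proof.
exists (center a), (c1 * delta ^ k); split; first by rewrite mulr_gt0.
exact: ball_sub_cube.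
Qed.

Lemma cube_bounded k (a : idx D k) : exists x r, 0 < r /\ cube a `<=` B x r.
Proof.
exists (center a), (C1 * delta ^ k); split; first by rewrite mulr_gt0.
exact: cube_sub_ball.
Qed.

Lemma mass_cube_lty k (a : idx D k) : (mass w (cube a) < +oo)%E.
Proof. by apply: mass_lty => //; [exact: measurable_cube|exact: cube_bounded]. Qed.

Lemma cube_outer_ball n k (a : idx D k) : C1 <= 2 ^+ n * c1 ->
  outer_ball a `<=` B (center a) (2 ^+ n * (c1 * delta ^ k)).
Proof. by move=> h; apply: sub_qball; rewrite mulrA ler_pM2r. Qed.

(** By the choice of [n], the inner ball of the cube, doubled [n] times, contains the outer ball. *)
Lemma comparable_outer_ball n k (a : idx D k) : C1 <= 2 ^+ n * c1 ->
  comparable_sets (Cmu ^+ n) (cube a) (outer_ball a).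
Proof.
move=> h; have r0 : 0 < c1 * delta ^ k by rewrite mulr_gt0.
split.
- exact: measurable_cube.
- exact: measurable_qball.
- exact: cube_sub_ball.
- exact: cube_fat.
- by exists (center a), (C1 * delta ^ k); split => //; rewrite mulr_gt0.
- apply: (@le_trans _ _ (vol X (B (center a) (2 ^+ n * (c1 * delta ^ k))))).
    apply: le_measure; rewrite ?inE; [exact: measurable_qball..|].
    exact: cube_outer_ball.
  apply: le_trans (vol_qball_scale _ _ r0) _.
  rewrite lee_wpmul2l ?lee_fin ?exprn_ge0 ?Cmu_ge0//.
  apply: le_measure; rewrite ?inE; [exact: measurable_qball| |].
    exact: measurable_cube.
  exact: ball_sub_cube.
Qed.

Lemma mass_outer_ball n C k (a : idx D k) : C1 <= 2 ^+ n * c1 ->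
  doubling w C -> (mass w (outer_ball a) <= (C ^+ n)%:E * mass w (cube a))%E.
Proof.
move=> h wC; have r0 : 0 < c1 * delta ^ k by rewrite mulr_gt0.
apply: (@le_trans _ _ (mass w (B (center a) (2 ^+ n * (c1 * delta ^ k))))).
  by apply: le_mass; [|exact: measurable_qball..|exact: cube_outer_ball].
apply: le_trans (doubling_scale w_weight _ _ wC r0) _.
rewrite lee_wpmul2l ?lee_fin ?exprn_ge0 ?(ltW (doubling_gt0 w_weight wC))//.
by apply: le_mass => //;
  [exact: measurable_qball|exact: measurable_cube|exact: ball_sub_cube].
Qed.

Lemma doubling_cube_gt0 C k (a : idx D k) : doubling w C -> (0 < mass w (cube a))%E.
Proof.
move=> wC; have r0 : 0 < c1 * delta ^ k by rewrite mulr_gt0.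
apply: lt_le_trans (doubling_qball_gt0 (center a) wC r0) _.
by apply: le_mass => //;
  [exact: measurable_qball|exact: measurable_cube|exact: ball_sub_cube].
Qed.

Lemma dyadic_doubling_gt0 C : dyadic_doubling D w C -> 0 < C.
Proof.
have [a _ _] : (\bigcup_(a in [set: idx D 0]) cube a) point by rewrite cube_cover.
have [b ab] := children_neq0 a.
move=> /(_ _ _ _ ab)[h1 h2 _].
have := lt_le_trans h1 h2; rewrite ltNge => /negP h; rewrite ltNge.
by apply/negP => C0; apply: h; rewrite mule_le0_ge0 ?lee_fin// mass_ge0.
Qed.

Lemma dyadic_doubling_le C C' : C <= C' ->
  dyadic_doubling D w C -> dyadic_doubling D w C'.
Proof.
move=> CC' wC k a b ab; have [h1 h2 h3] := wC k a b ab; split => //.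
  by apply: le_trans h2 _; rewrite lee_wpmul2r ?lee_fin// mass_ge0.
rewrite lte_mul_pinfty ?lee_fin//; last exact: mass_cube_lty.
exact: le_trans (ltW (dyadic_doubling_gt0 wC)) CC'.
Qed.

Lemma dyadic_doubling_cube_gt0 C k (a : idx D k) :
  dyadic_doubling D w C -> (0 < mass w (cube a))%E.
Proof. by move=> wC; have [b /wC[]] := children_neq0 a. Qed.

(** The outer ball of the parent contains the center of the child, so recentering it there gives a
    ball around the parent, which [n] doublings of the inner ball of the child cover. *)
Lemma dyadic_of_doubling n C : 2 * A0 * C1 <= 2 ^+ n * (c1 * delta) ->
  doubling w C -> dyadic_doubling D w (C ^+ n).
Proof.
move=> hn wC k a b ab.
have Cn0 : 0 <= C ^+ n by rewrite exprn_ge0 ?(ltW (doubling_gt0 w_weight wC)).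
have r0 : 0 < c1 * delta ^ (k + 1) by rewrite mulr_gt0.
split; first exact: doubling_cube_gt0 wC.
  apply: (@le_trans _ _ (mass w (B (center b) (2 ^+ n * (c1 * delta ^ (k + 1)))))).
    apply: le_mass => //; [exact: measurable_cube|exact: measurable_qball|].
    apply: subset_trans (cube_sub_ball (a := a)) _; apply: qball_recenter.
      exact/cube_sub_ball/ab/cube_center.
    rewrite expfzDr ?gt_eqF ?(delta_gt0 D)// expr1z.
    by rewrite mulrA [delta ^ k * _]mulrC !mulrA ler_pM2r// -!mulrA mulrA.
  apply: le_trans (doubling_scale w_weight _ _ wC r0) _.
  rewrite lee_wpmul2l ?lee_fin//.
  by apply: le_mass => //;
    [exact: measurable_qball|exact: measurable_cube|exact: ball_sub_cube].
by rewrite lte_mul_pinfty ?lee_fin//; exact: mass_cube_lty.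
Qed.

(** The chain follows the children that contain [x], each step costing a factor [C]. The generation
    [l] comes with an equation because the type of [b] depends on it, and [k + m + 1] equals
    [k + (m + 1)] only up to a proof. *)
Lemma dyadic_doubling_descend C m k (a : idx D k) x :
  dyadic_doubling D w C -> cube a x ->
  exists l (b : idx D l), [/\ l = k + m%:Z, cube b x &
    (mass w (cube a) <= (C ^+ m)%:E * mass w (cube b))%E].
Proof.
move=> wC ax; elim: m => [|m [l [b [lk bx hb]]]].
  by exists k, a; split; rewrite ?addr0 ?expr0 ?mul1e.
have [c bc cx] : (\bigcup_(c in children b) cube c) x by rewrite -cube_children.
exists (l + 1), c; split => //.
  by rewrite lk intS addrAC addrA.
apply: le_trans hb _; rewrite exprSr EFinM -muleA lee_wpmul2l//.
  by rewrite lee_fin exprn_ge0// ltW// (dyadic_doubling_gt0 wC).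
by case: (wC _ _ _ bc).
Qed.

End dyadic.
End space.

(** * Balls and cubes of adjacent systems *)

Section adjacent.
Context (R : realType) (A0 Cmu : R) (X : homogeneous_space A0 Cmu).
Context (delta : R) (T N : nat) (D : adjacent_systems X delta T N).

Local Notation C1 := (4 * A0 ^+ 2).
Local Notation dilation := (8 * A0 ^+ 3 * delta ^- 3).

Let A0_gt0 : 0 < A0. Proof. exact: lt_le_trans (A0_ge1 X). Qed.

(* If T = 0 no field of [adjacent_systems] makes delta positive; the covering
   property at k = -2, r = 1 only needs delta < 1. *)
Lemma adjacent_index : 'I_T.
Proof.
suff: (0 < T)%N by case: T => // T' _; exact: ord0.
have /(adjacent_cover D (point : X))[[t tT] _] :
    delta ^ (-2 + 3 : int) < 1 <= delta ^ (-2 + 2 : int); last first.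
  exact: leq_ltn_trans tT.
rewrite expr0z lexx andbT expr1z; apply: lt_trans (delta_lt D) _.
rewrite invf_lt1; last by rewrite mulr_gt0// exprn_gt0.
by have := exprn_ege1 6 (A0_ge1 X); lra.
Qed.

Lemma adjacent_delta01 : 0 < delta < 1.
Proof.
by rewrite (delta_gt0 (D adjacent_index)) (delta_lt1 (D adjacent_index)).
Qed.

(** With [delta ^ (k + 1) < r <= delta ^ k], the covering property applies in generation [k - 2].
    The lower bound on [r] is kept because a later descent from this cube needs its size. *)
Lemma adjacent_cube x r : 0 < r -> exists t k (a : idx (D t) k),
  [/\ delta ^ (k + 3) < r, B x r `<=` cube a & cube a `<=` B x (dilation * r)].
Proof.
move=> r0; have [k /andP[k1 k2]] := geometric_scale adjacent_delta01 r0.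
have [t [a [_ h1 h2]]] : exists t (a : idx (D t) (k - 2)),
    [/\ rho x (center a) < 2 * A0 * delta ^ (k - 2),
        B x r `<=` cube a & cube a `<=` B x (dilation * r)].
  by apply: adjacent_cover; rewrite subrK (_ : k - 2 + 3 = k + 1) ?k1//; ring.
exists t, (k - 2), a; split => //.
by rewrite (_ : k - 2 + 3 = k + 1) //; ring.
Qed.

Lemma comparable_adjacent n x r t k (a : idx (D t) k) :
  0 < r -> dilation <= 2 ^+ n -> B x r `<=` cube a ->
  cube a `<=` B x (dilation * r) -> comparable_sets (Cmu ^+ n) (B x r) (cube a).
Proof.
move=> r0 hn ra ar; split => //.
- exact: measurable_qball.
- exact: measurable_cube.
- by exists x, r; split.
- exact: cube_bounded.
- apply: le_trans (vol_qball_scale n x r0).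
  apply: le_measure; rewrite ?inE;
    [exact: measurable_cube|exact: measurable_qball|].
  by apply: subset_trans ar _; apply: sub_qball; rewrite ler_pM2r.
Qed.

Variable w : X -> \bar R.
Hypothesis w_weight : is_weight w.

Lemma mass_adjacent n C x r t k (a : idx (D t) k) :
  0 < r -> dilation <= 2 ^+ n -> cube a `<=` B x (dilation * r) ->
  doubling w C -> (mass w (cube a) <= (C ^+ n)%:E * mass w (B x r))%E.
Proof.
move=> r0 hn ar wC; apply: le_trans (doubling_scale w_weight n x wC r0).
apply: le_mass => //; [exact: measurable_cube|exact: measurable_qball|].
by apply: subset_trans ar _; apply: sub_qball; rewrite ler_pM2r.
Qed.

(** A cube [a] covers [B x (2 * r)], and its descendant [b] containing [x], [m] generations below,
    lies in [B x r]; dyadic doubling along the way gives the factor [C ^+ m]. *)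
Lemma doubling_of_dyadic m C : 4 * A0 * C1 * delta ^+ m <= delta ^+ 3 ->
  (forall t, dyadic_doubling (D t) w C) -> doubling w (C ^+ m).
Proof.
move=> hm wC x r r0.
have C0 : 0 < C := dyadic_doubling_gt0 w_weight (wC adjacent_index).
have r20 : 0 < 2 * r by rewrite mulr_gt0.
have [t [k [a [kr ra _]]]] := adjacent_cube x r20.
have ax : cube a x by apply: ra; exact: qball_center.
have [l [b [lk bx ab]]] := dyadic_doubling_descend w_weight m (wC t) ax.
have br : cube b `<=` B x r.
  apply: subset_trans (cube_sub_ball (a := b)) _.
  (* Recentering at [x] asks for [2 * A0 * C1 * delta ^ (k + m) <= r]; twice this follows from the
     choice of [m] and [delta ^ (k + 3) < 2 * r]. *)
  apply: qball_recenter; first exact/cube_sub_ball.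
  have /andP[d0 _] := adjacent_delta01.
  rewrite lk expfzDr ?gt_eqF// -exprnP -(ler_pM2l (ltr0n _ 2)).
  apply: le_trans (ltW kr); rewrite expfzDr ?gt_eqF// -exprnP.
  rewrite [leLHS](_ : _ = delta ^ k * (4 * A0 * C1 * delta ^+ m)); last by ring.
  by rewrite ler_pM2l// exprz_gt0.
have bmr : (mass w (cube b) <= mass w (B x r))%E.
  by apply: le_mass => //; [exact: measurable_cube|exact: measurable_qball].
have amr : (mass w (B x (2 * r)) <= mass w (cube a))%E.
  by apply: le_mass => //; [exact: measurable_qball|exact: measurable_cube].
have Cm0 : 0 <= C ^+ m by rewrite exprn_ge0// ltW.
split.
- apply: lt_le_trans (dyadic_doubling_cube_gt0 b (wC t)) (le_trans bmr _).
  apply: le_mass => //; [exact: measurable_qball..|].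
  by apply: sub_qball; rewrite ler_peMl ?ler1n// ltW.
- apply: le_trans amr (le_trans ab _).
  by rewrite lee_wpmul2l// lee_fin.
- rewrite lte_mul_pinfty ?lee_fin//; apply: mass_lty => //.
    exact: measurable_qball.
  by exists x, r; split.
Qed.

End adjacent.

(** * Logarithms in the extended reals *)

Section extended_real_functions.
Local Open Scope ereal_scope.
Context (R : realType).
Implicit Types (u : \bar R) (b l L : R).

Lemma ln_le (r : R) : (0 < r -> ln r <= r - 1)%R.
Proof.
move=> r0; have := @le_ln1Dx R (r - 1).
rewrite (_ : 1 + (r - 1) = r)%R; last by ring.
by apply; rewrite ltrBrDl subrr.
Qed.

(** This is [ln v <= v] at [v = u / b], read as a bound on the negative part of the logarithm of
    [b / u]. At [u = 0] that logarithm is +oo, and at [u = +oo] the right side is. *)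
Lemma lneV_funeneg_le b u : (0 < b)%R -> 0 <= u ->
  maxe (- (lne u^-1 + (ln b)%:E)) 0 <= u * (b^-1)%:E.
Proof.
move=> b0; have bV0 : (0 < b^-1)%R by rewrite invr_gt0.
case: u => [r||//]; rewrite ?lee_fin.
  rewrite le_eqVlt => /predU1P[<-|r0].
    by rewrite inve0 /= mul0e max_r// leNye.
  rewrite inver gt_eqF// lne_EFin ?invr_gt0// -EFinD -EFinN.
  have rb : (0 < r / b)%R by rewrite divr_gt0.
  rewrite ge_max -EFinM !lee_fin (ltW rb) andbT.
  rewrite lnV ?posrE// opprD opprK -ln_div ?posrE//.
  by apply: le_trans (ln_le rb) _; rewrite gerBl.
by rewrite mulyr gtr0_sg// mul1e => _; rewrite leey.
Qed.

(** From [ln (1 / u) <= 1 / u] comes [u * ln u >= -1]; at [u = 0] the product is 0 by convention. *)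
Lemma xlnx_funeneg_le u : 0 <= u -> maxe (- (u * lne u)) 0 <= 1.
Proof.
case: u => [r||//]; rewrite ?lee_fin.
  rewrite le_eqVlt => /predU1P[<-|r0].
    by rewrite mul0e oppe0 maxxx lee_fin.
  rewrite lne_EFin// -EFinM -EFinN ge_max !lee_fin ler01 andbT.
  rewrite -mulrN -lnV ?posrE//.
  apply: (@le_trans _ _ (r * r^-1)%R); last by rewrite mulfV ?gt_eqF.
  rewrite ler_pM2l//; apply: le_trans (ln_le _) _; rewrite ?invr_gt0//.
  by rewrite gerBl.
by move=> _; rewrite [lne _]/= mulyy /= max_r// ?leNye ?lee_fin.
Qed.

(** Used to change the normalization of a weight from one average to another, [l] being their ratio:
    the logarithm splits as [ln u + ln l], and [ln l <= ln L] with [ln L >= 0]. *)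
Lemma xlnx_scale_le l L u : (0 < l)%R -> (l <= L)%R -> (1 <= L)%R -> 0 <= u ->
  maxe ((u * l%:E) * lne (u * l%:E)) 0 <=
  L%:E * maxe (u * lne u) 0 + (L * ln L)%:E * u.
Proof.
move=> l0 lL L1; have L0 : (0 < L)%R by exact: lt_le_trans lL.
have lnL0 : (0 <= ln L)%R by exact: ln_ge0.
case: u => [r||//]; rewrite ?lee_fin.
  rewrite le_eqVlt => /predU1P[<-|r0].
    by rewrite !mul0e maxxx !mule0 adde0.
  rewrite -EFinM !lne_EFin ?mulr_gt0// -!EFinM -!EFin_max -EFinM -EFinD lee_fin.
  set P := Num.max (r * ln r)%R 0%R.
  have P0 : (0 <= P)%R by rewrite le_max lexx orbT.
  have rP : (r * ln r <= P)%R by rewrite le_max lexx.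
  have LnLr : (0 <= L * ln L * r)%R by rewrite !mulr_ge0// ltW.
  have LP : (0 <= L * P + L * ln L * r)%R by rewrite addr_ge0// mulr_ge0// ltW.
  rewrite ge_max LP andbT.
  rewrite lnM ?posrE// mulrDr lerD//.
    rewrite (_ : r * l * ln r = l * (r * ln r))%R; last by ring.
    by apply: le_trans (ler_wpM2l (ltW l0) rP) _; rewrite ler_wpM2r.
  rewrite (_ : L * ln L * r = (r * L) * ln L)%R; last by ring.
  apply: (@le_trans _ _ (r * l * ln L)%R).
    by rewrite ler_pM2l ?mulr_gt0// ler_ln ?posrE.
  by rewrite ler_wpM2r// ler_pM2l.
move=> _; rewrite [+oo * l%:E]mulyr gtr0_sg// mul1e [lne _]/= mulyy.
rewrite max_l ?leey// mulry gtr0_sg// mul1e.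
rewrite (@addye R) ?leey//.
by rewrite gt_eqF// (lt_le_trans (ltNye_eq 0)) ?mule_ge0 ?lee_fin// mulr_ge0// ltW.
Qed.

(** * Measurability, and integrals of positive and negative parts *)

Context d (T : measurableType d).
Implicit Type f : T -> \bar R.

Lemma measurable_lne_comp f : measurable_fun setT f ->
  measurable_fun setT (fun x => lne (f x)).
Proof.
move=> mf; apply: (measurability _ (ErealGenCInfty.measurableE R)) => //.
move=> _ [_ [r ->] <-]; rewrite [X in measurable X](_ : _ =
    setT `&` [set x | (expR r)%:E <= f x]).
  exact: emeasurable_fun_c_infty.
rewrite !setTI; apply/seteqP; split=> x /=; rewrite in_itv/= andbT => h.
  have fx0 : 0 <= f x by rewrite leNgt; apply/negP => /ltW /le0_lneNy fE; rewrite fE in h.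
  by rewrite -[f x]lneK ?in_itv/= ?fx0 ?leey// -[(expR r)%:E]/(expeR r%:E) lee_expeR.
have fx0 : 0 <= f x by apply: le_trans h; rewrite lee_fin expR_ge0.
by rewrite -lee_expeR lneK// in_itv/= fx0 leey.
Qed.

Lemma measurable_inve_comp f : (forall x, 0 <= f x) -> measurable_fun setT f ->
  measurable_fun setT (fun x => (f x)^-1).
Proof.
move=> f0 mf; apply: (measurability _ (ErealGenCInfty.measurableE R)) => //.
move=> _ [_ [r ->] <-]; have [r0|r0] := leP r 0%R.
  rewrite [X in measurable X](_ : _ = setT)//.
  rewrite setTI; apply/seteqP; split=> x //= _; rewrite in_itv/= andbT.
  by rewrite (@le_trans _ _ 0)// ?lee_fin// inve_ge0.
rewrite [X in measurable X](_ : _ = setT `&` [set x | f x <= (r%:E)^-1]).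
  exact: emeasurable_fun_infty_c.
rewrite !setTI; apply/seteqP; split=> x /=;
  by rewrite in_itv/= andbT inve_pge ?inE//= ?lee_fin ?ltW.
Qed.

Context (mu : {measure set T -> \bar R}).

Lemma integral_le_funepos (D : set T) f :
  \int[mu]_(x in D) f x <= \int[mu]_(x in D) f^\+ x.
Proof.
rewrite integralE geeDl// oppe_le0; apply: integral_ge0 => x _; exact: funeneg_ge0.
Qed.

(** The negative part has finite integral, so it can be moved across the inequality. A bound on a
    signed integral thus becomes one on a quantity monotone in the set. *)
Lemma integral_funepos_le (D : set T) f (a m : R) :
  \int[mu]_(x in D) f x <= a%:E -> \int[mu]_(x in D) f^\- x <= m%:E ->
  \int[mu]_(x in D) f^\+ x <= (a + m)%:E.
Proof.
rewrite integralE => fa fm.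
have N0 : 0 <= \int[mu]_(x in D) f^\- x by apply: integral_ge0 => x _; exact: funeneg_ge0.
rewrite leeBlDr in fa; first by rewrite (le_trans fa)// EFinD leeD2l.
by rewrite ge0_fin_numE// (le_lt_trans fm) ?ltry.
Qed.

Lemma integrable_of_funeposneg (D : set T) f : measurable D ->
  measurable_fun D f -> \int[mu]_(x in D) f^\+ x < +oo ->
  \int[mu]_(x in D) f^\- x < +oo -> mu.-integrable D f.
Proof.
move=> mD mf fp fn; apply/integrableP; split => //.
under eq_integral do rewrite -[`|f _|]/((abse \o f) _) fune_abse.
rewrite ge0_integralD//; first exact: lte_add_pinfty.
- exact: measurable_funepos.
- exact: measurable_funeneg.
Qed.

End extended_real_functions.

(** * Comparison of the weight quantities on two sets *)

(** [K] bounds the ratio of volumes, [C] the quantity on the larger set and, in the next definition,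
    [L] the ratio of masses. The value at -oo is arbitrary. *)
Definition muckenhoupt_bound (R : realType) (p : \bar R) (K C : R) : R :=
  match p with
  | q%:E => if q == 1 then K * C else K * K `^ (q - 1) * C
  | +oo%E => K * expR (K * (ln C + 1))
  | -oo%E => 0
  end.

Definition reverse_hoelder_bound (R : realType) (p : \bar R) (K L C : R) : R :=
  match p with
  | q%:E => if q == 1 then K * (L * (C + 1 + ln L)) else K `^ q^-1 * L * C
  | +oo%E => L * C
  | -oo%E => 0
  end.

Section comparison.
Local Open Scope ereal_scope.
Context (R : realType) (A0 Cmu : R) (X : homogeneous_space A0 Cmu).
Variables (K : R) (E F : set X).
Hypothesis EF : comparable_sets K E F.

Let mE := comparable_measl EF.
Let mF := comparable_measr EF.
Let sEF := comparable_sub EF.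
Let vE := fine (vol X E).
Let vF := fine (vol X F).

Let volE_lty : vol X E < +oo.
Proof.
apply: le_lt_trans (comparable_vol_lty EF).
by apply: le_measure; rewrite ?inE.
Qed.

Let volF_gt0 : 0 < vol X F.
Proof.
apply: lt_le_trans (comparable_vol_gt0 EF) _.
by apply: le_measure; rewrite ?inE.
Qed.

Let vEE : vol X E = vE%:E.
Proof. by rewrite fineK// ge0_fin_numE. Qed.

Let vFE : vol X F = vF%:E.
Proof. by rewrite fineK// ge0_fin_numE// (comparable_vol_lty EF). Qed.

Let vE_gt0 : (0 < vE)%R.
Proof. by rewrite -lte_fin -vEE (comparable_vol_gt0 EF). Qed.

Let vF_gt0 : (0 < vF)%R.
Proof. by rewrite -lte_fin -vFE. Qed.

Let vFK : (vF <= K * vE)%R.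
Proof. by rewrite -lee_fin EFinM -vEE -vFE (comparable_vol EF). Qed.

Let vEF : (vE <= vF)%R.
Proof. by rewrite -lee_fin -vEE -vFE; apply: le_measure; rewrite ?inE. Qed.

Let K_gt0 : (0 < K)%R.
Proof. by rewrite -(pmulr_lgt0 _ vE_gt0) (lt_le_trans vF_gt0). Qed.

Let avgE f : avg f E = (vE^-1)%:E * mass f E.
Proof. by rewrite /avg vEE inver gt_eqF. Qed.

Let avgF f : avg f F = (vF^-1)%:E * mass f F.
Proof. by rewrite /avg vFE inver gt_eqF. Qed.

Let vV_le : (vE^-1 <= K * vF^-1)%R.
Proof. by rewrite ler_pdivlMr// mulrC ler_pdivrMr. Qed.

Lemma le_avg f : measurable_fun setT f -> (forall x, 0 <= f x) ->
  avg f E <= K%:E * avg f F.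
Proof.
move=> mf f0; rewrite avgE avgF muleA -EFinM.
apply: lee_pmul => //.
- by rewrite lee_fin invr_ge0 ltW.
- exact: integral_ge0.
- apply: ge0_subset_integral => //; exact: measurable_funTS.
Qed.

(** * Muckenhoupt quantities on the two sets *)

Variable w : X -> \bar R.
Hypothesis w_weight : is_weight w.

Let mw : measurable_fun setT w. Proof. by case: w_weight. Qed.
Let w_ge0 x : 0 <= w x. Proof. by case: w_weight. Qed.

Lemma le_ess_inf_on : ess_inf_on w F <= ess_inf_on w E.
Proof.
apply: le_ereal_sup => y /=.
by apply: filterS => x h /sEF.
Qed.

Lemma le_ess_sup_on : ess_sup_on w E <= ess_sup_on w F.
Proof.
apply: le_ereal_inf => y /=.
by apply: filterS => x h /sEF.
Qed.

Lemma avg_ge0 (f : X -> \bar R) (D : set X) : (forall x, 0 <= f x) -> 0 <= avg f D.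
Proof.
by move=> f0; rewrite /avg mule_ge0 ?inve_ge0//; exact: integral_ge0.
Qed.

Lemma ess_inf_on_ge0 (D : set X) : 0 <= ess_inf_on w D.
Proof. by apply: ereal_sup_ubound => /=; apply: filterE => x _. Qed.

Let massF_lty : mass w F < +oo.
Proof. exact: mass_lty (comparable_bounded EF). Qed.

Let massE_lty : mass w E < +oo.
Proof. by apply: le_lt_trans massF_lty; exact: le_mass. Qed.

(** With [b] the average of [w] on [F], if positive, the hypothesis bounds the average of
    [h = ln (b / w)] on [F] by [ln C]. Its negative part has average at most 1, so its positive part
    has average at most [ln C + 1], which passes to [E] with a factor [K]. *)
Lemma muckenhoupt_on_infty_le (C : R) : muckenhoupt_on +oo w F <= C%:E ->
  muckenhoupt_on +oo w E <= (K * expR (K * (ln C + 1)))%:E.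
Proof.
rewrite /muckenhoupt_on; set f := fun x => lne (w x)^-1 => hC.
have mf : measurable_fun setT f.
  exact/measurable_lne_comp/measurable_inve_comp.
have aEF : avg w E <= K%:E * avg w F by exact: le_avg.
have aE0 := avg_ge0 E w_ge0; have := avg_ge0 F w_ge0.
rewrite le_eqVlt => /predU1P[aF0|aF0].
  have -> : avg w E = 0 by apply/eqP; rewrite eq_le aE0 (le_trans aEF)// -aF0 mule0.
  by rewrite mul0e lee_fin mulr_ge0 ?expR_ge0// ltW.
have aF_fin : avg w F \is a fin_num.
  rewrite ge0_fin_numE ?(ltW aF0)// avgF lte_mul_pinfty// lee_fin invr_ge0 ltW//.
set b := fine (avg w F); have bE : avg w F = b%:E by rewrite fineK.
have b0 : (0 < b)%R by rewrite -lte_fin -bE.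
have massFE : mass w F = (vF * b)%:E.
  by rewrite EFinM -bE avgF muleA -EFinM mulfV ?gt_eqF// mul1e.
(* Taken at [c = 1] to make [f] integrable, and at [c = b] to bound the negative part of [h] by
   [vF]. *)
have neg_le (c : R) : (0 < c)%R ->
    \int[vol X]_(x in F) (fun x => f x + (ln c)%:E)^\- x <= (c^-1 * (vF * b))%:E.
  move=> c0; have mwF : measurable_fun F w by exact: measurable_funTS.
  have cV0 : 0 <= (c^-1)%:E by rewrite lee_fin invr_ge0 ltW.
  rewrite EFinM -massFE muleC -ge0_integralZr//.
  apply: ge0_le_integral => //.
  - apply: measurable_funTS; apply: measurable_funeneg.
    by apply: emeasurable_funD.
  - by apply: measurable_funTS; apply: emeasurable_funM.
  - by move=> x _; rewrite funenegE; exact: lneV_funeneg_le.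
have f_neg : \int[vol X]_(x in F) f^\- x <= (vF * b)%:E.
  have := neg_le _ ltr01; rewrite invr1 mul1r ln1.
  by rewrite (_ : (fun x => f x + 0%:E) = f)//; apply/funext => x; rewrite adde0.
(* An integral of [f] equal to +oo would make the quantity infinite, and -oo is excluded by the
   bound on the negative part; for a real value one takes logarithms. *)
have [C0 f_le] : (0 < C)%R /\ \int[vol X]_(x in F) f x <= (vF * (ln C - ln b))%:E.
  have := hC; rewrite bE avgF; case fE : (mass f F) => [r||].
  - rewrite /= => h.
    have hr : (expR (vF^-1 * r) <= C / b)%R.
      by rewrite ler_pdivlMr// mulrC -lee_fin.
    have C0 : (0 < C)%R.
      have := lt_le_trans (expR_gt0 _) hr.
      by rewrite pmulr_lgt0 ?invr_gt0.
    have CbV0 : (0 < C / b)%R by rewrite divr_gt0.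
    split => //; rewrite -[integral _ _ _]/(mass f F) fE lee_fin -ler_pdivrMl//.
    by rewrite -ln_div ?posrE// -(expRK (vF^-1 * r)%R) ler_ln ?posrE ?expR_gt0.
  - by rewrite mulry gtr0_sg ?invr_gt0// mul1e /= mulry gtr0_sg// mul1e.
  - move: fE; rewrite /mass integralE => fE.
    have : - (\int[vol X]_(x in F) f^\- x) <= -oo.
      rewrite -fE leeDr//; apply: integral_ge0 => x _; exact: funepos_ge0.
    rewrite leeNl /= leye_eq => /eqP fNy.
    by rewrite fNy in f_neg.
have f_int : (vol X).-integrable F f.
  apply: integrable_of_funeposneg => //.
  - exact: measurable_funTS.
  - by apply: le_lt_trans (integral_funepos_le f_le f_neg) _; rewrite ltry.
  - by apply: le_lt_trans f_neg _; rewrite ltry.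
pose h x := f x + (ln b)%:E.
have cst_int D : measurable D -> vol X D < +oo ->
    (vol X).-integrable D (fun=> (ln b)%:E).
  by move=> mD D_lty; apply/integrableP; split => //;
    rewrite integral_cst//= lte_mul_pinfty.
have integral_lnb D : measurable D ->
    \int[vol X]_(x in D) (ln b)%:E = (ln b)%:E * vol X D.
  by move=> mD; exact: integral_cst.
have h_le : \int[vol X]_(x in F) h x <= (vF * ln C)%:E.
  rewrite integralD//; last by apply: cst_int => //; rewrite vFE ltry.
  rewrite integral_lnb// vFE -EFinM; apply: le_trans (leeD2r _ f_le) _.
  by rewrite -EFinD lee_fin mulrC mulrBl [(vF * _)%R]mulrC; lra.
have h_pos : \int[vol X]_(x in F) h^\+ x <= (vF * (ln C + 1))%:E.
  have := integral_funepos_le h_le (neg_le _ b0).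
  by rewrite mulrCA mulVf ?gt_eqF// mulr1 mulrDr mulr1.
(* This sign allows [vF] to be replaced by [K * vE] below. *)
have lnC0 : (0 <= ln C + 1)%R.
  rewrite -(pmulr_rge0 _ vF_gt0) -lee_fin; apply: le_trans h_pos.
  by apply: integral_ge0 => x _; exact: funepos_ge0.
have fE_le : avg f E <= (K * (ln C + 1) - ln b)%:E.
  have h_leE : \int[vol X]_(x in E) h x <= (vF * (ln C + 1))%:E.
    apply: le_trans (integral_le_funepos _ _ _) _; apply: le_trans h_pos.
    apply: ge0_subset_integral => //.
    apply: measurable_funTS; apply: measurable_funepos.
    exact: emeasurable_funD.
  move: h_leE; rewrite integralD//; last 2 first.
  - exact: integrableS f_int.
  - by apply: cst_int => //; rewrite vEE ltry.
  rewrite integral_lnb// vEE -EFinM -leeBrDr// -EFinB => fE_le.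
  rewrite avgE lee_pdivrMl//; apply: le_trans fE_le _.
  rewrite -EFinM lee_fin mulrBr [(vE * ln b)%R]mulrC lerB// mulrA [(vE * K)%R]mulrC.
  by rewrite ler_wpM2r.
apply: (@le_trans _ _ ((K * b)%:E * (expR (K * (ln C + 1) - ln b))%:E)).
  apply: lee_pmul => //; first exact: expeR_ge0.
    by rewrite EFinM -bE.
  by rewrite -[leRHS]/(expeR _%:E) lee_expeR.
rewrite -EFinM lee_fin expRD expRN lnK ?posrE//.
by rewrite mulrCA mulfK ?gt_eqF// mulrC.
Qed.

(** For finite exponents each average loses a factor [K], the dual one to the power [q - 1]; for
    [q = 1] the essential infimum can only decrease as the set grows. *)
Lemma muckenhoupt_on_le p C : 1 <= p -> muckenhoupt_on p w F <= C%:E ->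
  muckenhoupt_on p w E <= (muckenhoupt_bound p K C)%:E.
Proof.
case: p => [q||_ _//]; last by move=> _; exact: muckenhoupt_on_infty_le.
rewrite lee_fin => q1; rewrite /muckenhoupt_on /muckenhoupt_bound.
case: eqP => [_|/eqP q_neq1] hC.
  rewrite EFinM; apply: le_trans (lee_wpmul2l _ hC); last by rewrite lee_fin ltW.
  rewrite muleA; apply: lee_pmul; rewrite ?inve_ge0 ?avg_ge0 ?ess_inf_on_ge0//.
    exact: le_avg.
  by rewrite lee_pV2 ?inE ?ess_inf_on_ge0//; exact: le_ess_inf_on.
have q0 : (0 < q - 1)%R by rewrite subr_gt0 lt_neqAle eq_sym q_neq1.
set f := fun x => (w x)^-1 `^ (q - 1)^-1 in hC *.
have f0 x : 0 <= f x by exact: poweR_ge0.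
have mf : measurable_fun setT f.
  apply: (measurableT_comp (measurable_poweR _)).
  exact: measurable_inve_comp.
rewrite EFinM; apply: le_trans (lee_wpmul2l _ hC); last first.
  by rewrite lee_fin mulr_ge0// ?powR_ge0// ltW.
rewrite EFinM -poweR_EFin muleACA; apply: lee_pmul.
- exact: avg_ge0.
- exact: poweR_ge0.
- exact: le_avg.
- rewrite -poweRM ?avg_ge0 ?lee_fin ?(ltW K_gt0)//.
  apply: gt0_ler_poweR; rewrite ?in_itv/= ?leey ?andbT ?avg_ge0 ?(ltW q0)//.
    by rewrite mule_ge0 ?avg_ge0// lee_fin ltW.
  exact: le_avg.
Qed.

(** A negative essential upper bound of a nonnegative function would make [F] null. *)
Lemma ess_sup_on_ge0 (f : X -> \bar R) : (forall x, 0 <= f x) ->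
  0 <= ess_sup_on f F.
Proof.
move=> f0; apply: le_ereal_inf_tmp => y /= [A [mA volA hA]].
rewrite leNgt; apply/negP => y0; have := volF_gt0; rewrite ltNge => /negP; apply.
rewrite -volA; apply: le_measure; rewrite ?inE// => x Fx; apply: hA => /= /(_ Fx).
by rewrite leNgt (lt_le_trans y0).
Qed.

(** * Reverse Hoelder quantities on the two sets *)

Variable L : R.
Hypothesis massE_gt0 : 0 < mass w E.
Hypothesis massFL : mass w F <= L%:E * mass w E.

Let aE := fine (avg w E).
Let aF := fine (avg w F).

Let aEE : avg w E = aE%:E.
Proof.
rewrite fineK// avgE ge0_fin_numE ?lte_mul_pinfty ?mule_ge0 ?lee_fin ?invr_ge0
  ?(ltW vE_gt0)//.
all: by rewrite ?mass_ge0.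
Qed.

Let massF_gt0 : 0 < mass w F.
Proof. by apply: lt_le_trans massE_gt0 _; exact: le_mass. Qed.

Let aFE : avg w F = aF%:E.
Proof.
rewrite fineK// avgF ge0_fin_numE ?lte_mul_pinfty ?mule_ge0 ?lee_fin ?invr_ge0
  ?(ltW vF_gt0)//.
all: by rewrite ?mass_ge0.
Qed.

Let aE_gt0 : (0 < aE)%R.
Proof. by rewrite -lte_fin -aEE avgE mule_gt0// lte_fin invr_gt0. Qed.

Let aF_gt0 : (0 < aF)%R.
Proof. by rewrite -lte_fin -aFE avgF mule_gt0// lte_fin invr_gt0. Qed.

Let massEE : mass w E = (vE * aE)%:E.
Proof. by rewrite EFinM -aEE avgE muleA -EFinM mulfV ?gt_eqF// mul1e. Qed.

Let massFE : mass w F = (vF * aF)%:E.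
Proof. by rewrite EFinM -aFE avgF muleA -EFinM mulfV ?gt_eqF// mul1e. Qed.

Let L_ge1 : (1 <= L)%R.
Proof.
have : mass w E <= L%:E * mass w E by apply: le_trans massFL; exact: le_mass.
by rewrite massEE -EFinM lee_fin -ler_pdivrMr ?mulr_gt0// mulfV// gt_eqF// mulr_gt0.
Qed.

Let L_gt0 : (0 < L)%R. Proof. exact: lt_le_trans L_ge1. Qed.

Let aFL : (aF <= L * aE)%R.
Proof.
have := massFL; rewrite massEE massFE -EFinM lee_fin => h.
rewrite -(ler_pM2l vF_gt0); apply: le_trans h _.
by rewrite mulrCA ler_wpM2r// mulr_ge0// ltW.
Qed.

Let avgV_le : (avg w E)^-1 <= L%:E * (avg w F)^-1.
Proof.
rewrite aEE aFE !inver !gt_eqF// -EFinM lee_fin.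
by rewrite ler_pdivlMr// mulrC ler_pdivrMr.
Qed.

(** With [u = w / aF], the negative part of [u * ln u] is at most 1, so its positive part has
    average at most [C + 1] on [F]. Normalizing by [aE] multiplies [u] by [l = aF / aE <= L]; as [u]
    has average 1, this turns the bound into [L * (C + 1) + L * ln L]. *)
Lemma reverse_hoelder_on_1_le C : reverse_hoelder_on 1 w F <= C%:E ->
  reverse_hoelder_on 1 w E <= (K * (L * (C + 1 + ln L)))%:E.
Proof.
rewrite /reverse_hoelder_on eqxx aEE aFE !inver !gt_eqF// => hC.
pose u x := w x * (aF^-1)%:E; pose g x := u x * lne (u x).
have u0 x : 0 <= u x by rewrite mule_ge0// lee_fin invr_ge0 ltW.
have mu : measurable_fun setT u by exact: emeasurable_funM.
have mxlnx (v : X -> \bar R) : measurable_fun setT v ->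
    measurable_fun setT (fun x => v x * lne (v x)).
  by move=> mv; apply: emeasurable_funM => //; exact: measurable_lne_comp.
have mg : measurable_fun setT g by exact: mxlnx.
have int_u : \int[vol X]_(x in F) u x = vF%:E.
  rewrite ge0_integralZr//; last 2 first.
  - exact: measurable_funTS.
  - by rewrite lee_fin invr_ge0 ltW.
  by rewrite -[integral _ _ _]/(mass w F) massFE -EFinM mulfK ?gt_eqF.
have g_pos : \int[vol X]_(x in F) g^\+ x <= (vF * (C + 1))%:E.
  rewrite mulrDr mulr1; apply: integral_funepos_le.
    by rewrite EFinM -lee_pdivrMl// -avgF.
  apply: (@le_trans _ _ (\int[vol X]_(x in F) 1)).
    apply: ge0_le_integral => //.
    - exact/measurable_funTS/measurable_funeneg.
    - by move=> x _; rewrite funenegE; exact: xlnx_funeneg_le.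
  by rewrite integral_cst// mul1e -vFE.
pose l := (aF / aE)%R.
have l0 : (0 < l)%R by rewrite divr_gt0.
have lL : (l <= L)%R by rewrite ler_pdivrMr.
have wl x : w x * (aE^-1)%:E = u x * l%:E.
  by rewrite /u -muleA -EFinM /l mulrA mulVf ?gt_eqF// mul1r.
have lnL0 : (0 <= ln L)%R by exact: ln_ge0.
have LlnL0 : (0 <= L * ln L)%R by rewrite mulr_ge0// ltW.
set f := (fun x => _); have fE : f = (fun x => (u x * l%:E) * lne (u x * l%:E)).
  by apply/funext => x; rewrite /f wl.
have mf : measurable_fun setT f.
  by rewrite fE; apply: (mxlnx (fun x => u x * l%:E)); exact: emeasurable_funM.
have f_le : \int[vol X]_(x in F) f^\+ x <=
    L%:E * \int[vol X]_(x in F) g^\+ x + (L * ln L)%:E * \int[vol X]_(x in F) u x.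
  rewrite -ge0_integralZl//; last 2 first.
  - exact/measurable_funTS/measurable_funepos.
  - by rewrite lee_fin ltW.
  rewrite -ge0_integralZl//; last exact: measurable_funTS.
  rewrite -ge0_integralD//; last 4 first.
  - by move=> x _; rewrite mule_ge0// lee_fin ltW.
  - by apply/measurable_funTS/emeasurable_funM => //; exact: measurable_funepos.
  - by move=> x _; rewrite mule_ge0.
  - by apply/measurable_funTS/emeasurable_funM.
  apply: ge0_le_integral => //.
  - exact/measurable_funTS/measurable_funepos.
  - apply/measurable_funTS/emeasurable_funD; apply: emeasurable_funM => //.
    exact: measurable_funepos.
  - by move=> x _; rewrite fE !funeposE; exact: xlnx_scale_le.
rewrite avgE; apply: (@le_trans _ _ ((K * vF^-1)%:E * (vF * (L * (C + 1 + ln L)))%:E)).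
  have pos0 : 0 <= \int[vol X]_(x in F) f^\+ x.
    by apply: integral_ge0 => x _; exact: funepos_ge0.
  apply: (@le_trans _ _ ((vE^-1)%:E * \int[vol X]_(x in F) f^\+ x)).
    rewrite lee_wpmul2l ?lee_fin ?invr_ge0 ?(ltW vE_gt0)//.
    apply: (le_trans (integral_le_funepos _ _ _)).
    by apply: ge0_subset_integral => //; exact/measurable_funTS/measurable_funepos.
  apply: lee_pmul; rewrite ?lee_fin ?invr_ge0 ?(ltW vE_gt0)//.
  apply: le_trans f_le _; rewrite int_u.
  have Lg : L%:E * \int[vol X]_(x in F) g^\+ x <= L%:E * (vF * (C + 1))%:E.
    by rewrite lee_wpmul2l// lee_fin ltW.
  apply: le_trans (leeD2r _ Lg) _.
  by rewrite -!EFinM -EFinD lee_fin le_eqVlt; apply/orP; left; apply/eqP; ring.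
by rewrite -EFinM lee_fin (mulrA (K / vF)%R) divfK ?gt_eqF.
Qed.

(** The power mean contributes [K] to the power [1 / q] and the inverse average [L]; for [p = +oo]
    the essential supremum is monotone and only [L] remains. *)
Lemma reverse_hoelder_on_le p C : 1 <= p -> reverse_hoelder_on p w F <= C%:E ->
  reverse_hoelder_on p w E <= (reverse_hoelder_bound p K L C)%:E.
Proof.
case: p => [q||_ _//]; last first.
  move=> _ hC; rewrite /reverse_hoelder_on /reverse_hoelder_bound EFinM.
  apply: le_trans (lee_wpmul2l _ hC); last by rewrite lee_fin ltW.
  rewrite muleCA; apply: (@le_trans _ _ (ess_sup_on w F * (avg w E)^-1)).
    by rewrite lee_wpmul2r ?inve_ge0 ?avg_ge0//; exact: le_ess_sup_on.
  by rewrite lee_wpmul2l// ess_sup_on_ge0.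
rewrite lee_fin => q1; case: (eqVneq q 1%R) => [->|q_neq1] hC.
  by rewrite /reverse_hoelder_bound eqxx; exact: reverse_hoelder_on_1_le.
have q0 : (0 < q)%R by exact: lt_le_trans q1.
move: hC; rewrite /reverse_hoelder_on /reverse_hoelder_bound (negPf q_neq1) => hC.
set f := fun x => w x `^ q in hC *.
have f0 x : 0 <= f x by exact: poweR_ge0.
have mf : measurable_fun setT f by exact: (measurableT_comp (measurable_poweR _)).
rewrite EFinM; apply: le_trans (lee_wpmul2l _ hC); last first.
  by rewrite lee_fin mulr_ge0// ?powR_ge0// ltW.
rewrite EFinM -poweR_EFin muleACA; apply: lee_pmul => //.
- exact: poweR_ge0.
- by rewrite inve_ge0 avg_ge0.
- rewrite -poweRM ?avg_ge0 ?lee_fin ?(ltW K_gt0)//.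
  have qV0 : (0 <= q^-1)%R by rewrite invr_ge0 ltW.
  apply: gt0_ler_poweR; rewrite ?in_itv/= ?leey ?andbT ?avg_ge0//.
    by rewrite mule_ge0 ?avg_ge0// lee_fin ltW.
  exact: le_avg.
Qed.

End comparison.

(** * One parameter *)

(** [n] counts doublings and [m] generations. In order: from the inner to the outer ball of a cube,
    from the inner ball of a child to a ball around its parent, from a ball to the dilate containing
    its adjacent cube, and down from the cube covering a doubled ball to one inside the ball. *)
Definition scale_exponents (R : realType) (A0 delta : R) (n m : nat)
    (c1 := (12 * A0 ^+ 4)^-1) (C1 := 4 * A0 ^+ 2) : Prop :=
  [/\ C1 <= 2 ^+ n * c1, 2 * A0 * C1 <= 2 ^+ n * (c1 * delta),
      8 * A0 ^+ 3 * delta ^- 3 <= 2 ^+ n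
    & 4 * A0 * C1 * delta ^+ m <= delta ^+ 3].

(** The conditions stand under the existential so that the exponents can be selected from the
    constants alone, before any space is given. *)
Lemma ex_scale_exponents (R : realType) (A0 delta : R) :
  exists nm : nat * nat,
    1 <= A0 -> 0 < delta < 1 -> scale_exponents A0 delta nm.1 nm.2.
Proof.
have [A1|] := boolP (1 <= A0); last by exists (0, 0)%N.
have [d01|] := boolP (0 < delta < 1); last by exists (0, 0)%N.
have A0_gt0 : 0 < A0 by exact: lt_le_trans A1.
have [d0 d1] := andP d01.
set c1 := (12 * A0 ^+ 4)^-1; pose C1 := 4 * A0 ^+ 2.
have c1_gt0 : 0 < c1 by rewrite invr_gt0 mulr_gt0// exprn_gt0.
have C1_gt0 : 0 < C1 by rewrite mulr_gt0// exprn_gt0.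
have [n hn] := exp2_dominates (Num.max (C1 / c1)
  (Num.max (2 * A0 * C1 / (c1 * delta)) (8 * A0 ^+ 3 * delta ^- 3))).
have q0 : 0 < 4 * A0 * C1 by rewrite !mulr_gt0.
have [m hm] := expr_below d01 (divr_gt0 (exprn_gt0 3 d0) q0).
exists (n, m) => _ _; move: hn; rewrite !ge_max => /and3P[h1 h2 h3].
split => //=.
- by rewrite -ler_pdivrMr.
- by rewrite -ler_pdivrMr// mulr_gt0.
- by rewrite mulrC -ler_pdivlMr// ltW.
Qed.

Section one_parameter.
Context (R : realType) (A0 Cmu : R) (X : homogeneous_space A0 Cmu).
Context (delta : R) (T N : nat) (D : adjacent_systems X delta T N).
Implicit Types (w : X -> \bar R) (p : \bar R) (F : set (set X)).

Lemma muckenhoupt_le F p w C C' : C <= C' ->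
  muckenhoupt F p w C -> muckenhoupt F p w C'.
Proof. by move=> CC' h; apply: le_trans h _; rewrite lee_fin. Qed.

Lemma reverse_hoelder_le F p w C C' : C <= C' ->
  reverse_hoelder F p w C -> reverse_hoelder F p w C'.
Proof. by move=> CC' h; apply: le_trans h _; rewrite lee_fin. Qed.

Variables n m : nat.
Hypothesis nm : scale_exponents A0 delta n m.

Lemma doubling_dyadic w C t : is_weight w -> doubling w C ->
  dyadic_doubling (D t) w (C ^+ n).
Proof. by case: nm => _ h _ _ ww; exact: dyadic_of_doubling. Qed.

Lemma dyadic_doubling_doubling w C : is_weight w ->
  (forall t, dyadic_doubling (D t) w C) -> doubling w (C ^+ m).
Proof. by case: nm => _ _ _ h ww; exact: doubling_of_dyadic. Qed.

Lemma muckenhoupt_dyadic p w C t : (1 <= p)%E -> is_weight w ->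
  muckenhoupt balls p w C ->
  muckenhoupt (cubes (D t)) p w (muckenhoupt_bound p (Cmu ^+ n) C).
Proof.
case: nm => h _ _ _ p1 ww wC; apply: ub_ereal_sup => _ [_ [k [a ->]] <-].
apply: (muckenhoupt_on_le (comparable_outer_ball a h) ww p1).
apply: le_trans wC; apply: ereal_sup_ubound; exists (outer_ball a) => //.
exists (center a), (4 * A0 ^+ 2 * delta ^ k); split => //.
have A0_gt0 := lt_le_trans ltr01 (A0_ge1 X).
by rewrite !mulr_gt0 ?exprn_gt0// exprz_gt0// (delta_gt0 (D t)).
Qed.

(** The system whose cube is adjacent to a ball varies with the ball, so the bound is assumed in all
    of them. *)
Lemma dyadic_muckenhoupt p w C : (1 <= p)%E -> is_weight w ->
  (forall t, muckenhoupt (cubes (D t)) p w C) ->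
  muckenhoupt balls p w (muckenhoupt_bound p (Cmu ^+ n) C).
Proof.
case: nm => _ _ h _ p1 ww wC; apply: ub_ereal_sup => _ [_ [x [r [r0 ->]]] <-].
have [t [k [a [_ ra ar]]]] := adjacent_cube D x r0.
apply: (muckenhoupt_on_le (comparable_adjacent r0 h ra ar) ww p1).
apply: le_trans (wC t); apply: ereal_sup_ubound; exists (cube a) => //.
by exists k, a.
Qed.

Lemma reverse_hoelder_dyadic p w C t : (1 <= p)%E -> is_weight w ->
  reverse_hoelder balls p w C -> doubling w C ->
  dyadic_reverse_hoelder (D t) p w
    (Num.max (reverse_hoelder_bound p (Cmu ^+ n) (C ^+ n) C) (C ^+ n)).
Proof.
case: (nm) => h _ _ _ p1 ww wC wD; split; last first.
  apply: (dyadic_doubling_le ww (C := C ^+ n)); last exact: doubling_dyadic.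
  by rewrite le_max lexx orbT.
apply: (@reverse_hoelder_le _ _ _ (reverse_hoelder_bound p (Cmu ^+ n) (C ^+ n) C)).
  by rewrite le_max lexx.
apply: ub_ereal_sup => _ [_ [k [a ->]] <-].
apply: (reverse_hoelder_on_le (comparable_outer_ball a h) ww
  (doubling_cube_gt0 ww a wD) (mass_outer_ball ww a h wD) p1).
apply: le_trans wC; apply: ereal_sup_ubound; exists (outer_ball a) => //.
exists (center a), (4 * A0 ^+ 2 * delta ^ k); split => //.
have A0_gt0 := lt_le_trans ltr01 (A0_ge1 X).
by rewrite !mulr_gt0 ?exprn_gt0// exprz_gt0// (delta_gt0 (D t)).
Qed.

(** Doubling is derived first, with constant [C'], because comparing the masses of a ball and its
    adjacent cube needs it; the ratio is [C' ^+ n]. *)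
Lemma dyadic_reverse_hoelder_balls p w C (C' := C ^+ m) :
  (1 <= p)%E -> is_weight w ->
  (forall t, dyadic_reverse_hoelder (D t) p w C) ->
  let M := Num.max (reverse_hoelder_bound p (Cmu ^+ n) (C' ^+ n) C) C' in
  reverse_hoelder balls p w M /\ doubling w M.
Proof.
case: (nm) => _ _ h _ p1 ww wC M.
have wD : doubling w C' by apply: dyadic_doubling_doubling => // t; case: (wC t).
split; last by apply: (doubling_le ww (C := C') _ wD); rewrite le_max lexx orbT.
apply: (@reverse_hoelder_le _ _ _ (reverse_hoelder_bound p (Cmu ^+ n) (C' ^+ n) C)).
  by rewrite le_max lexx.
apply: ub_ereal_sup => _ [_ [x [r [r0 ->]]] <-].
have [t [k [a [_ ra ar]]]] := adjacent_cube D x r0.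
apply: (reverse_hoelder_on_le (comparable_adjacent r0 h ra ar) ww
  (doubling_qball_gt0 x wD r0) (mass_adjacent ww r0 h ar wD) p1).
apply: le_trans (proj1 (wC t)); apply: ereal_sup_ubound; exists (cube a) => //.
by exists k, a.
Qed.

End one_parameter.

(** * Products *)

Section transfer.
Context (R : realType) (k : nat) (g : 'I_k -> geometry R)
  (X : forall j, homogeneous_space (geo_A0 (g j)) (geo_Cmu (g j))).
Implicit Types (w : product_carrier X -> \bar R) (j : 'I_k).

Let ae_filter j : Filter (almost_everywhere (other_vol X j)).
Proof. exact: ae_filter_ringOfSetsType. Qed.

(** Restricted to weights: enlarging a doubling constant uses nonnegative masses and local
    integrability. *)
Definition class_monotone (cls : forall j, weight_class (X j)) :=
  forall j (v : X j -> \bar R) C C', is_weight v -> C <= C' ->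
    cls j v C -> cls j v C'.

Lemma uniformly_in_le cls w C C' : class_monotone cls -> C <= C' ->
  uniformly_in cls w C -> uniformly_in cls w C'.
Proof.
move=> mono CC' wC j; apply: (filterS (Filter := ae_filter j) _ (wC j)) => z [ww hw].
by split => //; exact: mono CC' hw.
Qed.

(** An infimum at most [M] yields an admissible constant only strictly above [M], hence the shift by
    1. *)
Lemma product_constant_uniformly_in cls w M : class_monotone cls ->
  (product_constant cls w <= M%:E)%E -> uniformly_in cls w (M + 1).
Proof.
move=> mono wM.
have /ereal_inf_lt[_ [C wC <-]] : (product_constant cls w < (M + 1)%:E)%E.
  by apply: le_lt_trans wM _; rewrite lte_fin ltrDl.
by rewrite lte_fin => /ltW CM; exact: uniformly_in_le wC.
Qed.

Lemma uniformly_in_product_constant cls w C : uniformly_in cls w C ->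
  (product_constant cls w <= C%:E)%E.
Proof. by move=> wC; apply: ereal_inf_lbound; exists C. Qed.

Definition class_conj (cls cls' : forall j, weight_class (X j)) j :
  weight_class (X j) := fun v C => cls j v C /\ cls' j v C.

Section conjunction.
Variables cls cls' : forall j, weight_class (X j).
Hypotheses (mono : class_monotone cls) (mono' : class_monotone cls').

Lemma class_conj_monotone : class_monotone (class_conj cls cls').
Proof.
move=> j v C C' vw CC' [h h'].
by split; [exact: mono CC' h|exact: mono' CC' h'].
Qed.

Lemma uniformly_in_conj w C C' :
  uniformly_in cls w C -> uniformly_in cls' w C' ->
  uniformly_in (class_conj cls cls') w (Num.max C C').
Proof.
move=> wC wC' j; apply: (filterS2 (ae_filter j) _ (wC j) (wC' j)) => z [ww h] [_ h'].
split => //; split.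
  by apply: mono h => //; rewrite le_max lexx.
by apply: mono' h' => //; rewrite le_max lexx orbT.
Qed.

Lemma conj_uniformly_in w C : uniformly_in (class_conj cls cls') w C ->
  uniformly_in cls w C /\ uniformly_in cls' w C.
Proof.
by move=> wC; split=> j; apply: (filterS (Filter := ae_filter j) _ (wC j)) => z [ww []].
Qed.

Lemma product_class_conj :
  product_class cls `&` product_class cls' = product_class (class_conj cls cls').
Proof.
apply/seteqP; split=> w.
  move=> [[ww [C wC]] [_ [C' wC']]]; split => //; exists (Num.max C C').
  exact: uniformly_in_conj.
by move=> [ww [C /conj_uniformly_in[wC wC']]]; split; split => //; exists C.
Qed.

(** By monotonicity, admissible [C] and [C'] for the two classes make [Num.max C C'] admissible for
    both, so the infimum commutes with the maximum. *)
Lemma product_constant_conj w :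
  maxe (product_constant cls w) (product_constant cls' w) =
  product_constant (class_conj cls cls') w.
Proof.
apply/eqP; rewrite eq_le; apply/andP; split.
  rewrite ge_max; apply/andP; split; apply: le_ereal_inf => _ [C wC <-];
    by exists C => //; have [] := conj_uniformly_in wC.
rewrite leNgt; apply/negP; rewrite gt_max => /andP[].
move=> /ereal_inf_lt[_ [C wC <-] hC] /ereal_inf_lt[_ [C' wC' <-] hC'].
have := uniformly_in_product_constant (uniformly_in_conj wC wC').
by rewrite leNgt EFin_max gt_max hC hC'.
Qed.

End conjunction.

(** * Transfer from one parameter to products *)

Variable T : 'I_k -> nat.
Variable t0 : forall j, 'I_(T j).
Variable cls : forall j, weight_class (X j).
Variable clsd : forall j, 'I_(T j) -> weight_class (X j).
Variables phi psi : 'I_k -> R -> R.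
Local Notation cls_at t := (fun j => @clsd j (t j)).
Hypothesis mono : class_monotone cls.
Hypothesis monod : forall t : forall j, 'I_(T j), class_monotone (cls_at t).
Hypothesis to_dyadic : forall j s (v : X j -> \bar R) C,
  is_weight v -> cls v C -> clsd s v (phi j C).
Hypothesis of_dyadic : forall j (v : X j -> \bar R) C,
  is_weight v -> (forall s, @clsd j s v C) -> cls v (psi j C).

(** Absolute values make the sum dominate the bound of every coordinate at once. *)
Definition joint_bound (chi : 'I_k -> R -> R) C := \sum_j `|chi j C|.

Let le_joint_bound chi j C : chi j C <= joint_bound chi C.
Proof.
by rewrite /joint_bound (bigD1 j)//= ler_wpDr ?ler_norm ?sumr_ge0.
Qed.

Let uniformly_in_dyadic w C t : uniformly_in cls w C ->
  uniformly_in (cls_at t) w (joint_bound phi C).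
Proof.
move=> wC j; apply: (filterS (Filter := ae_filter j) _ (wC j)) => z [ww h]; split => //.
exact: (monod (t := t) ww (le_joint_bound _ _ _) (to_dyadic _ ww h)).
Qed.

(** The condition in coordinate [j] sees only the entry [t j], so the remaining entries can be
    filled by [t0]. *)
Let at_index j (s : 'I_(T j)) : forall i, 'I_(T i) := dfwith t0 j s.

Let dyadic_uniformly_in w C : (forall t, uniformly_in (cls_at t) w C) ->
  uniformly_in cls w (joint_bound psi C).
Proof.
move=> wC j.
have : {ae other_vol X j, forall z, forall s,
    let v (y : X j) := w (insert z y) in is_weight v /\ clsd s v C}.
  (* There are finitely many systems [s], so the union of the exceptional sets is null. *)
  apply: (filter_forall (ae_filter j)) => s; have := wC (at_index s) j.
  by rewrite /at_index dfwithin.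
apply: (filterS (Filter := ae_filter j)) => z h; have [ww _] := h (t0 j); split => //.
apply: (mono ww (le_joint_bound _ _ _)); apply: of_dyadic => // s.
by have [] := h s.
Qed.

Lemma product_class_transfer w :
  product_class cls w <-> forall t, product_class (cls_at t) w.
Proof.
split=> [[ww [C wC]] t|h].
  by split => //; exists (joint_bound phi C); exact: uniformly_in_dyadic.
have ww : is_product_weight X w by case: (h t0).
split => //.
have /choice[f hf] : forall t, exists C, uniformly_in (cls_at t) w C.
  by move=> t; case: (h t).
(* The tuples [at_index s] suffice, and this finite sum dominates the constant of each. *)
pose C := \sum_j \sum_(s : 'I_(T j)) `|f (at_index s)|.
exists (joint_bound psi C); apply: dyadic_uniformly_in => t j.
apply: (filterS (Filter := ae_filter j) _ (hf (at_index (t j)) j)) => z.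
rewrite {1}/at_index dfwithin => -[vw hv]; split => //.
apply: (monod (t := t) vw _ hv); rewrite /C (bigD1 j)//= (bigD1 (t j))//=.
rewrite -addrA ler_wpDr ?ler_norm// addr_ge0 ?sumr_ge0// => i _.
by rewrite sumr_ge0.
Qed.

Lemma product_constant_transfer w :
  comparable_constants (fun M => joint_bound phi (M + 1))
    (fun M => joint_bound psi (M + 1))
    (product_constant cls w) (fun t => product_constant (cls_at t) w).
Proof.
split=> M wM => [t|]; apply: uniformly_in_product_constant.
  exact/uniformly_in_dyadic/product_constant_uniformly_in.
by apply: dyadic_uniformly_in => t; exact: product_constant_uniformly_in.
Qed.

End transfer.

(** * Monotonicity of the classes in the constant *)

Section dyadic_class_monotone.
Context (R : realType) (k : nat) (g : 'I_k -> geometry R)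
  (X : forall j, homogeneous_space (geo_A0 (g j)) (geo_Cmu (g j)))
  (D : forall j, adjacent_systems (X j)
    (geo_delta (g j)) (geo_T (g j)) (geo_N (g j)))
  (t : forall j, 'I_(geo_T (g j))).

Lemma Dbl_monotone : class_monotone (Dbl X).
Proof. by move=> j v C C' vw; exact: doubling_le. Qed.

Lemma Dbl_d_monotone : class_monotone (Dbl_d D t).
Proof. by move=> j v C C' vw; exact: dyadic_doubling_le. Qed.

Lemma Ap_monotone p : class_monotone (Ap X p).
Proof. by move=> j v C C' _; exact: muckenhoupt_le. Qed.

Lemma Ap_d_monotone p : class_monotone (Ap_d D t p).
Proof. by move=> j v C C' _; exact: muckenhoupt_le. Qed.

Lemma RH_monotone p : class_monotone (RH X p).
Proof. by move=> j v C C' _; exact: reverse_hoelder_le. Qed.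

Lemma RH_d_monotone p : class_monotone (RH_d D t p).
Proof.
move=> j v C C' vw CC' [h h']; split; first exact: reverse_hoelder_le h.
exact: dyadic_doubling_le h'.
Qed.

End dyadic_class_monotone.

(* In the last item the weights on the left are also required to be product
   doubling, the constant being the larger of the two, exactly as the dyadic
   classes on the right require dyadic doubling. A reverse Hoelder inequality on
   balls does not imply doubling in a general space of homogeneous type: on two
   points a, b at distance 1 with counting measure, w(a) = 1 and w(b) = e have
   all RH_p constants at most 2 on balls, but each dyadic doubling constant is
   (1 + e) / e. *)
Theorem theorem3p2 (R : realType) (k : nat) (k_gt0 : (0 < k)%N)
    (g : 'I_k -> geometry R) :
  [/\ exists Phi Psi : R -> R,
        forall (X : forall j, homogeneous_space (geo_A0 (g j)) (geo_Cmu (g j)))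
          (D : forall j, adjacent_systems (X j)
             (geo_delta (g j)) (geo_T (g j)) (geo_N (g j))),
          (forall w, is_product_weight X w ->
            product_class (Dbl X) w <->
            forall t, product_class (Dbl_d D t) w) /\
          (forall w, is_product_weight X w ->
            comparable_constants Phi Psi (product_constant (Dbl X) w)
              (fun t => product_constant (Dbl_d D t) w)),
      forall p : \bar R, (1 <= p)%E -> exists Phi Psi : R -> R,
        forall (X : forall j, homogeneous_space (geo_A0 (g j)) (geo_Cmu (g j)))
          (D : forall j, adjacent_systems (X j)
             (geo_delta (g j)) (geo_T (g j)) (geo_N (g j))),
          product_class (Ap X p) =
            \bigcap_t product_class (Ap_d D t p) /\
          (forall w, is_product_weight X w ->
            comparable_constants Phi Psi (product_constant (Ap X p) w)
              (fun t => product_constant (Ap_d D t p) w))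
    & forall p : \bar R, (1 <= p)%E -> exists Phi Psi : R -> R,
        forall (X : forall j, homogeneous_space (geo_A0 (g j)) (geo_Cmu (g j)))
          (D : forall j, adjacent_systems (X j)
             (geo_delta (g j)) (geo_T (g j)) (geo_N (g j))),
          product_class (RH X p) `&` product_class (Dbl X) =
            \bigcap_t product_class (RH_d D t p) /\
          (forall w, is_product_weight X w ->
            comparable_constants Phi Psi
              (maxe (product_constant (RH X p) w)
                    (product_constant (Dbl X) w))
              (fun t => product_constant (RH_d D t p) w))].
Proof.
(* The exponents are chosen from [g] alone, so that the bounds below are fixed before [X] and
   [D]. *)
have /choice[nm nmP] j := ex_scale_exponents (geo_A0 (g j)) (geo_delta (g j)).
pose n j := (nm j).1; pose m j := (nm j).2.
pose K j := geo_Cmu (g j) ^+ n j.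
have scales (X : forall j, homogeneous_space (geo_A0 (g j)) (geo_Cmu (g j)))
    (D : forall j, adjacent_systems (X j)
      (geo_delta (g j)) (geo_T (g j)) (geo_N (g j))) j :
    scale_exponents (geo_A0 (g j)) (geo_delta (g j)) (n j) (m j).
  by apply: nmP; [exact: A0_ge1 (X j)|exact: adjacent_delta01 (D j)].
split=> [|p p1|p p1].
- pose phi j (C : R) := C ^+ n j; pose psi j (C : R) := C ^+ m j.
  exists (fun M => joint_bound phi (M + 1)), (fun M => joint_bound psi (M + 1)).
  move=> X D; pose t0 j := adjacent_index (D j).
  pose clsd j t : weight_class (X j) := dyadic_doubling (D j t).
  have to_dyadic j t v C : is_weight v -> Dbl X j v C -> clsd j t v (phi j C).
    by move=> vw; exact: (doubling_dyadic (scales X D j)).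
  have of_dyadic j v C : is_weight v -> (forall t, clsd j t v C) ->
      Dbl X j v (psi j C).
    by move=> vw; exact: (dyadic_doubling_doubling (scales X D j)).
  have mono := @Dbl_monotone _ _ _ X.
  have monod t := @Dbl_d_monotone _ _ _ _ D t.
  split=> w _.
    exact: (product_class_transfer (clsd := clsd) t0 mono monod to_dyadic of_dyadic).
  exact: (product_constant_transfer (clsd := clsd) t0 mono monod to_dyadic of_dyadic).
- pose phi j C := muckenhoupt_bound p (K j) C.
  exists (fun M => joint_bound phi (M + 1)), (fun M => joint_bound phi (M + 1)).
  move=> X D; pose t0 j := adjacent_index (D j).
  pose clsd j t : weight_class (X j) := muckenhoupt (cubes (D j t)) p.
  have to_dyadic j t v C : is_weight v -> Ap X p j v C -> clsd j t v (phi j C).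
    by move=> vw h; exact: (muckenhoupt_dyadic (D j) (scales X D j) t p1 vw h).
  have of_dyadic j v C : is_weight v -> (forall t, clsd j t v C) ->
      Ap X p j v (phi j C).
    by move=> vw h; exact: (dyadic_muckenhoupt (scales X D j) p1 vw h).
  have mono := @Ap_monotone _ _ _ X p.
  have monod t := @Ap_d_monotone _ _ _ _ D t p.
  split=> [|w _]; last first.
    exact: (product_constant_transfer (clsd := clsd) t0 mono monod to_dyadic of_dyadic).
  have tr := product_class_transfer (clsd := clsd) t0 mono monod to_dyadic of_dyadic.
  apply/seteqP; split=> w.
    by move=> /tr h t _; exact: h.
  by move=> h; apply/tr => t; exact: h.
- pose phi j C := Num.max (reverse_hoelder_bound p (K j) (C ^+ n j) C) (C ^+ n j).
  pose psi j C := Num.max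
    (reverse_hoelder_bound p (K j) ((C ^+ m j) ^+ n j) C) (C ^+ m j).
  exists (fun M => joint_bound phi (M + 1)), (fun M => joint_bound psi (M + 1)).
  move=> X D; pose t0 j := adjacent_index (D j).
  have mRH := @RH_monotone _ _ _ X p; have mDbl := @Dbl_monotone _ _ _ X.
  (* The two classes on balls become one class with a single constant, to which the transfer
     applies. *)
  rewrite product_class_conj//.
  pose cls := class_conj (RH X p) (Dbl X).
  have mono : class_monotone cls by exact: class_conj_monotone.
  have monod t := @RH_d_monotone _ _ _ _ D t p.
  pose clsd j t : weight_class (X j) := dyadic_reverse_hoelder (D j t) p.
  have to_dyadic j t v C : is_weight v -> cls j v C -> clsd j t v (phi j C).
    move=> vw [h h'].
    exact: (reverse_hoelder_dyadic (D j) (scales X D j) t p1 vw h h').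
  have of_dyadic j v C : is_weight v -> (forall t, clsd j t v C) ->
      cls j v (psi j C).
    by move=> vw h; exact: (dyadic_reverse_hoelder_balls (scales X D j) p1 vw h).
  split=> [|w _]; last first.
    rewrite product_constant_conj//.
    exact: (product_constant_transfer (clsd := clsd) t0 mono monod to_dyadic of_dyadic).
  have tr := product_class_transfer (clsd := clsd) t0 mono monod to_dyadic of_dyadic.
  apply/seteqP; split=> w.
    by move=> /tr h t _; exact: h.
  by move=> h; apply/tr => t; exact: h.
Qed.
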